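(* If $G$ is a free group of finite rank and $\phi:G\to G$ is a monomorphism, then the ascending HNN extension $G_{\phi}$ is highly residually finite.
   Context: For a group monomorphism $\phi:G\to G$, the ascending HNN extension of $G$ with respect to $\phi$ is $G_{\phi}=\langle G,t\mid t^{-1}gt=\phi(g)\ \text{for all } g\in G\rangle$. For a group $\Gamma$, let $\hat{\Gamma}$ be its profinite completion and $c_\Gamma:\Gamma\to\hat{\Gamma}$ the completion map. For a nonnegative integer $n$, $\mathcal{A}_n$ is the class of all groups $\Gamma$ such that, for every finite discrete $\hat{\Gamma}$-module $A$, the map $H^i_c(\hat{\Gamma},A)\to H^i(\Gamma,A)$ induced by $c_\Gamma$, from continuous to ordinary (discrete) group cohomology, is bijective for $0\leq i\leq n$ and injective for $i=n+1$ (equivalently, surjective for $0\le i\le n$). A group $\Gamma$ is highly residually finite if it is residually finite and belongs to $\mathcal{A}_2$; equivalently, for every group extension $1\to F\to E\to \Gamma\to 1$ with $F$ finite, $E$ is residually finite; equivalently, for every group extension $1\to N\to E\to\Gamma\to1$ with $N$ finitely generated and residually finite, $E$ is residually finite. *)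

(* Defs.v *)
From HB Require Import structures.
From mathcomp Require Import all_boot all_algebra.
From mathcomp Require Import mathcomp_extra boolp classical_sets functions.
From mathcomp Require Import cardinality topology.

Set Implicit Arguments.
Unset Strict Implicit.
Unset Printing Implicit Defensive.

Import GRing.Theory.

Local Open Scope classical_set_scope.
Local Open Scope quotient_scope.
Local Open Scope group_scope.

Section FreeGroup.
Variable X : choiceType.

(* The letter (x, true) stands for x and (x, false) for its inverse. *)
Definition word := seq (X * bool).

Inductive word_eq : word -> word -> Prop :=
| word_eq_refl u : word_eq u u
| word_eq_sym u v : word_eq u v -> word_eq v u
| word_eq_trans u v w : word_eq u v -> word_eq v w -> word_eq u w
| word_eq_cancel u v x b :
    word_eq (u ++ [:: (x, b), (x, ~~ b) & v]) (u ++ v).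

Lemma word_eq_equiv : equiv_class_of (fun u v => `[< word_eq u v >]).
Proof.
split=> [u|u v|v u w]; first exact/asboolP/word_eq_refl.
  by apply/asboolP/asboolP; apply: word_eq_sym.
by move=> /asboolP uv /asboolP vw; apply/asboolP/(word_eq_trans uv).
Qed.

Definition word_eq_equiv_rel := EquivRelPack word_eq_equiv.

Definition free_group : Type := {eq_quot word_eq_equiv_rel}.
HB.instance Definition _ := Choice.on free_group.
HB.instance Definition _ := EqQuotient.on free_group.

Lemma word_eqE (u v : word) : \pi_free_group u = \pi v <-> word_eq u v.
Proof. by split=> [/eqmodP/asboolP//|uv]; apply/eqmodP/asboolP. Qed.

Lemma word_eq_cat u u' v v' :
  word_eq u u' -> word_eq v v' -> word_eq (u ++ v) (u' ++ v').
Proof.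
move=> uu' vv'; apply: (@word_eq_trans _ (u' ++ v)).
  elim: uu' => [w|w w' _|w w' w'' _ h _|w w' x b].
  - exact: word_eq_refl.
  - exact: word_eq_sym.
  - exact: word_eq_trans.
  - by rewrite -!catA; apply: word_eq_cancel.
elim: vv' => [w|w w' _|w w' w'' _ h _|w w' x b].
- exact: word_eq_refl.
- exact: word_eq_sym.
- exact: word_eq_trans.
- by rewrite !catA; apply: word_eq_cancel.
Qed.

Definition word_inv (u : word) : word := rev [seq (p.1, ~~ p.2) | p <- u].

Lemma word_invK : involutive word_inv.
Proof.
move=> u; rewrite /word_inv map_rev revK -map_comp map_id_in//.
by move=> -[x b] _ /=; rewrite negbK.
Qed.

Lemma word_inv_eq u v : word_eq u v -> word_eq (word_inv u) (word_inv v).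
Proof.
elim=> [w|w w' _|w w' w'' _ h _|w w' x b].
- exact: word_eq_refl.
- exact: word_eq_sym.
- exact: word_eq_trans.
rewrite /word_inv !map_cat !rev_cat /= !rev_cons -!cats1 -!catA /= negbK.
exact: word_eq_cancel.
Qed.

Lemma word_mulV u : word_eq (u ++ word_inv u) [::].
Proof.
elim/last_ind: u => [|u [x b] IHu]; first exact: word_eq_refl.
rewrite /word_inv map_rcons rev_rcons -cats1 -catA /=.
exact: word_eq_trans (word_eq_cancel _ _ _ _) IHu.
Qed.

Definition free_one : free_group := \pi_free_group [::].
Definition free_mul (a b : free_group) : free_group :=
  \pi_free_group (repr a ++ repr b).
Definition free_inv (a : free_group) : free_group :=
  \pi_free_group (word_inv (repr a)).

Lemma repr_word u : word_eq (repr (\pi_free_group u)) u.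
Proof. by apply/word_eqE; rewrite reprK. Qed.

Lemma free_mulA : associative free_mul.
Proof.
move=> a b c; apply/word_eqE/(@word_eq_trans _ (repr a ++ repr b ++ repr c)).
  by apply: word_eq_cat (word_eq_refl _) (repr_word _).
by rewrite catA; apply/word_eq_sym/word_eq_cat/word_eq_refl/repr_word.
Qed.

Lemma free_mul1 : left_id free_one free_mul.
Proof.
move=> a; rewrite -[RHS]reprK; apply/word_eqE.
exact: word_eq_cat (repr_word [::]) (word_eq_refl _).
Qed.

Lemma free_mulr1 : right_id free_one free_mul.
Proof.
move=> a; rewrite -[RHS]reprK; apply/word_eqE; rewrite -[X in word_eq _ X]cats0.
exact: word_eq_cat (word_eq_refl _) (repr_word [::]).
Qed.

Lemma free_mulgV : right_inverse free_one free_inv free_mul.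
Proof.
move=> a; apply/word_eqE; apply: word_eq_trans (word_mulV (repr a)).
exact: word_eq_cat (word_eq_refl _) (repr_word _).
Qed.

Lemma free_mulVg : left_inverse free_one free_inv free_mul.
Proof.
move=> a; apply/word_eqE; apply: word_eq_trans (word_mulV (word_inv (repr a))).
by rewrite word_invK; apply: word_eq_cat (repr_word _) (word_eq_refl _).
Qed.

HB.instance Definition _ := isGroup.Build free_group
  free_mulA free_mul1 free_mulr1 free_mulVg free_mulgV.

Definition free_gen (x : X) : free_group := \pi_free_group [:: (x, true)].

End FreeGroup.

Definition free_of_finite_rank (G : groupType) : Prop :=
  exists n (f : {multiplicative free_group 'I_n -> G}), bijective f.

Record normal_subgroup (G : groupType) := NormalSubgroup {
  normal_set :> set G;
  normal1 : normal_set 1;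
  normalM : forall x y, normal_set x -> normal_set y -> normal_set (x * y);
  normalV : forall x, normal_set x -> normal_set x^-1;
  normalJ : forall x g, normal_set x -> normal_set (x ^ g)
}.

Section NormalClosure.
Variables (G : groupType) (R : set G).

Definition normal_closure_set : set G :=
  [set x | forall N : normal_subgroup G, R `<=` N -> normal_set N x].

Lemma normal_closure1 : normal_closure_set 1.
Proof. by move=> N _; apply: normal1. Qed.

Lemma normal_closureM x y :
  normal_closure_set x -> normal_closure_set y -> normal_closure_set (x * y).
Proof. by move=> xR yR N RN; apply: normalM; [apply: xR|apply: yR]. Qed.

Lemma normal_closureV x : normal_closure_set x -> normal_closure_set x^-1.
Proof. by move=> xR N RN; apply: normalV; apply: xR. Qed.

Lemma normal_closureJ x g : normal_closure_set x -> normal_closure_set (x ^ g).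
Proof. by move=> xR N RN; apply: normalJ; apply: xR. Qed.

Definition normal_closure : normal_subgroup G := NormalSubgroup
  normal_closure1 normal_closureM normal_closureV normal_closureJ.

End NormalClosure.

Section QuotientGroup.
Variables (G : groupType) (N : normal_subgroup G).

Lemma coset_equiv : equiv_class_of (fun x y : G => `[< normal_set N (x^-1 * y) >]).
Proof.
split=> [x|x y|y x z]; first by apply/asboolP; rewrite mulVg; apply: normal1.
  by apply/asboolP/asboolP => /normalV; rewrite invgM invgK.
move=> /asboolP xy /asboolP yz; apply/asboolP.
by have := normalM xy yz; rewrite -mulgA mulVKg.
Qed.

Definition coset_equiv_rel := EquivRelPack coset_equiv.

Definition quotient_group : Type := {eq_quot coset_equiv_rel}.
HB.instance Definition _ := Choice.on quotient_group.
HB.instance Definition _ := EqQuotient.on quotient_group.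

Lemma cosetE (x y : G) : \pi_quotient_group x = \pi y <-> normal_set N (x^-1 * y).
Proof. by split=> [/eqmodP/asboolP//|xy]; apply/eqmodP/asboolP. Qed.

Definition quot_one : quotient_group := \pi_quotient_group 1.
Definition quot_mul (a b : quotient_group) : quotient_group :=
  \pi_quotient_group (repr a * repr b).
Definition quot_inv (a : quotient_group) : quotient_group :=
  \pi_quotient_group (repr a)^-1.

Lemma quot_mulE (x y : G) : quot_mul (\pi x) (\pi y) = \pi_quotient_group (x * y).
Proof.
apply/cosetE; set x' := repr _; set y' := repr _.
have xx' : normal_set N (x'^-1 * x) by apply/cosetE; rewrite reprK.
have yy' : normal_set N (y'^-1 * y) by apply/cosetE; rewrite reprK.
have := normalM (normalJ y' xx') yy'.
by rewrite /conjg invgM -!mulgA mulVKg.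
Qed.

Lemma quot_mulA : associative quot_mul.
Proof.
move=> a b c; rewrite -[a]reprK -[b]reprK -[c]reprK.
by rewrite !quot_mulE mulgA.
Qed.

Lemma quot_mul1 : left_id quot_one quot_mul.
Proof. by move=> a; rewrite -[a]reprK quot_mulE mul1g. Qed.

Lemma quot_mulr1 : right_id quot_one quot_mul.
Proof. by move=> a; rewrite -[a]reprK quot_mulE mulg1. Qed.

Lemma quot_mulVg : left_inverse quot_one quot_inv quot_mul.
Proof. by move=> a; rewrite -[X in quot_mul _ X]reprK quot_mulE mulVg. Qed.

Lemma quot_mulgV : right_inverse quot_one quot_inv quot_mul.
Proof. by move=> a; rewrite -[X in quot_mul X _]reprK quot_mulE mulgV. Qed.

HB.instance Definition _ := isGroup.Build quotient_group
  quot_mulA quot_mul1 quot_mulr1 quot_mulVg quot_mulgV.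

Definition coset_map (x : G) : quotient_group := \pi_quotient_group x.

Lemma coset_mapM : {morph coset_map : x y / x * y}.
Proof. by move=> x y; rewrite /coset_map -quot_mulE. Qed.

HB.instance Definition _ := isMultiplicative.Build _ _ coset_map coset_mapM.

End QuotientGroup.

Arguments coset_map {G} N x.

(* For N contained in M, this is the projection G/N -> G/M. *)
Definition transition (G : groupType) (N M : normal_subgroup G)
  (a : quotient_group N) : quotient_group M := coset_map M (repr a).

Arguments transition {G} N M a.

Section Transition.
Variables (G : groupType) (N M : normal_subgroup G) (NM : N `<=` M).

Lemma transitionE (x : G) : transition N M (coset_map N x) = coset_map M x.
Proof. by apply/cosetE/NM/cosetE; rewrite reprK. Qed.

Lemma transitionM : {morph transition N M : a b / a * b}.
Proof.
move=> a b; rewrite -[a]reprK -[b]reprK -!/(coset_map N _).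
by rewrite -gmulfM !transitionE gmulfM.
Qed.

Lemma transition1 : transition N M 1 = 1.
Proof. exact: transitionE. Qed.

Lemma transitionV (a : quotient_group N) :
  transition N M a^-1 = (transition N M a)^-1.
Proof.
apply: (@mulgI _ (transition N M a)).
by rewrite mulgV -transitionM mulgV transition1.
Qed.

End Transition.


Section HNN.
Variables (G : groupType) (phi : {multiplicative G -> G}).

(* The generators of the presentation are the elements of G, embedded by Some,
   and the stable letter t = None. *)
Let gen (g : G) : free_group (option G) := free_gen (Some g).
Let t : free_group (option G) := free_gen None.

Definition hnn_relators : set (free_group (option G)) :=
  [set r | (exists g h, r = gen g * gen h * (gen (g * h))^-1) \/
           (exists g, r = t^-1 * gen g * t * (gen (phi g))^-1)].

Definition ascending_hnn : groupType :=
  quotient_group (normal_closure hnn_relators).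

End HNN.

Definition finite_index (G : groupType) (N : normal_subgroup G) : Prop :=
  finite_set [set: quotient_group N].

Definition residually_finite (G : groupType) : Prop :=
  forall g : G, g <> 1 ->
    exists2 N : normal_subgroup G, finite_index N & ~ normal_set N g.

Section ProfiniteCompletion.
Variable G : groupType.

Definition fin_normal := {N : normal_subgroup G | finite_index N}.

Definition finite_quotients : Type := prod_topology
  (fun N : fin_normal => discrete_topology (quotient_group (sval N))).
HB.instance Definition _ := Topological.on finite_quotients.

Definition compatible : set finite_quotients :=
  [set x | forall N M : fin_normal, sval N `<=` sval M ->
     transition (sval N) (sval M) (x N) = x M].

Definition profinite_completion : Type := set_type compatible.
HB.instance Definition _ := Topological.on profinite_completion.

Definition mk_profinite (x : finite_quotients) (cx : compatible x) :
  profinite_completion := exist _ x (mem_set cx).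

Definition profinite_proj (x : profinite_completion) (N : fin_normal) :
  quotient_group (sval N) := sval x N.

Lemma profinite_eq (x y : profinite_completion) :
  (forall N, profinite_proj x N = profinite_proj y N) -> x = y.
Proof. by move=> xy; apply/val_inj/functional_extensionality_dep. Qed.

Lemma profinite_projP (x : profinite_completion) (N M : fin_normal) :
  sval N `<=` sval M ->
  transition (sval N) (sval M) (profinite_proj x N) = profinite_proj x M.
Proof. exact: (set_mem (svalP x)). Qed.

Lemma compatible_one : compatible (fun=> 1).
Proof. by move=> N M NM; apply: transition1. Qed.

Lemma compatible_mul (x y : profinite_completion) :
  compatible (fun N => profinite_proj x N * profinite_proj y N).
Proof.
move=> N M NM.
by rewrite (transitionM NM) !profinite_projP.
Qed.

Lemma compatible_inv (x : profinite_completion) :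
  compatible (fun N => (profinite_proj x N)^-1).
Proof. by move=> N M NM; rewrite (transitionV NM) profinite_projP. Qed.

Lemma compatible_coset (g : G) : compatible (fun N => coset_map (sval N) g).
Proof. by move=> N M NM; apply: transitionE. Qed.

Definition prof_one := mk_profinite compatible_one.
Definition prof_mul x y := mk_profinite (compatible_mul x y).
Definition prof_inv x := mk_profinite (compatible_inv x).

Lemma prof_mulA : associative prof_mul.
Proof. by move=> x y z; apply: profinite_eq => N; apply: mulgA. Qed.

Lemma prof_mul1 : left_id prof_one prof_mul.
Proof. by move=> x; apply: profinite_eq => N; apply: mul1g. Qed.

Lemma prof_mulr1 : right_id prof_one prof_mul.
Proof. by move=> x; apply: profinite_eq => N; apply: mulg1. Qed.

Lemma prof_mulVg : left_inverse prof_one prof_inv prof_mul.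
Proof. by move=> x; apply: profinite_eq => N; apply: mulVg. Qed.

Lemma prof_mulgV : right_inverse prof_one prof_inv prof_mul.
Proof. by move=> x; apply: profinite_eq => N; apply: mulgV. Qed.

HB.instance Definition _ := isGroup.Build profinite_completion
  prof_mulA prof_mul1 prof_mulr1 prof_mulVg prof_mulgV.

Definition completion_map (g : G) : profinite_completion :=
  mk_profinite (compatible_coset g).

Lemma completion_mapM : {morph completion_map : x y / x * y}.
Proof. by move=> x y; apply: profinite_eq => N; apply: coset_mapM. Qed.

HB.instance Definition _ :=
  isMultiplicative.Build _ _ completion_map completion_mapM.

End ProfiniteCompletion.

Record gmodule (G : groupType) := GModule {
  gmodule_sort :> zmodType;
  gact : G -> gmodule_sort -> gmodule_sort;
  gact1 : forall a, gact 1 a = a;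
  gactM : forall g h a, gact (g * h) a = gact g (gact h a);
  gactD : forall g a b, gact g (a + b)%R = (gact g a + gact g b)%R
}.

Section Restriction.
Variables (G H : groupType) (c : {multiplicative G -> H}) (A : gmodule H).

Let act (g : G) (a : A) : A := gact (c g) a.

Let act1 a : act 1 a = a.
Proof.
have c1 : c 1 = 1 by apply: (@mulgI _ (c 1)); rewrite -gmulfM !mulg1.
by rewrite /act c1 gact1.
Qed.

Let actM g h a : act (g * h) a = act g (act h a).
Proof. by rewrite /act gmulfM gactM. Qed.

Let actD g a b : act g (a + b)%R = (act g a + act g b)%R.
Proof. exact: gactD. Qed.

Definition restrict_module : gmodule G := GModule act1 actM actD.

End Restriction.

Section Cochains.
Variables (G : groupType) (A : gmodule G).

Definition cochain (n : nat) : Type := ('I_n -> G) -> A.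
HB.instance Definition _ n := GRing.Zmodule.on (cochain n).

End Cochains.

(* merge_at i sends (g_0, ..., g_n) to (g_0, ..., g_i g_(i+1), ..., g_n). *)
Definition merge_at (G : groupType) (n : nat) (i : 'I_n) (g : 'I_n.+1 -> G)
    (j : 'I_n) : G :=
  let gl := g (widen_ord (leqnSn n) j) in
  let gr := g (lift ord0 j) in
  if (j < i)%N then gl else if j == i then gl * gr else gr.

(* The differential of the inhomogeneous (bar) cochain complex. *)
Definition differential (G : groupType) (A : gmodule G) (n : nat)
    (f : cochain A n) : cochain A n.+1 := fun g =>
  (gact (g ord0) (f (fun j => g (lift ord0 j)))
   + \sum_(i < n) f (merge_at i g) *~ (-1) ^+ i.+1
   + f (fun j => g (widen_ord (leqnSn n) j)) *~ (-1) ^+ n.+1)%R.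

Lemma gactB (G : groupType) (A : gmodule G) (g : G) (a b : A) :
  gact g (a - b)%R = (gact g a - gact g b)%R.
Proof. by apply: (@addIr _ (gact g b)); rewrite -gactD !subrK. Qed.

Lemma differentialB (G : groupType) (A : gmodule G) (n : nat)
  (f f' : cochain A n) :
  (differential (f - f') = differential f - differential f')%R.
Proof.
apply/funext => g; rewrite [RHS]/(_ - _)%R /= /differential.
have E x : ((f - f') x = f x - f' x)%R by [].
rewrite !E gactB mulrzBl; under eq_bigr do rewrite E mulrzBl.
by rewrite sumrB !opprD [RHS]addrACA; congr (_ + _)%R; rewrite addrACA.
Qed.

Lemma differential0 (G : groupType) (A : gmodule G) (n : nat) :
  (differential (0 : cochain A n) = 0)%R.
Proof. by rewrite -[X in differential X](subrr 0%R) differentialB subrr. Qed.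

(* A choice of admissible cochains in each degree: all of them for the
   cohomology of an abstract group, the continuous ones for a profinite group. *)
Record cochain_family (G : groupType) (A : gmodule G) := CochainFamily {
  family_set :> forall n, set (cochain A n);
  family0 : forall n, @family_set n 0%R;
  familyB : forall n f f', @family_set n f -> @family_set n f' ->
    @family_set n (f - f')%R
}.

Section Cohomology.
Variables (G : groupType) (A : gmodule G) (C : cochain_family A) (n : nat).

Definition is_cocycle (f : cochain A n) : Prop :=
  C n f /\ differential f = 0%R.

Definition cocycle : Type := {f : cochain A n | `[< is_cocycle f >]}.
HB.instance Definition _ := Choice.on cocycle.

Definition is_coboundary : set (cochain A n) :=
  match n return set (cochain A n) with
  | 0 => [set 0%R]
  | m.+1 => [set f | exists2 h : cochain A m, C m h & f = differential h]
  end.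

Lemma is_coboundary0 : is_coboundary 0%R.
Proof.
rewrite /is_coboundary; case: n => [|m]//=; exists 0%R; first exact: family0.
by rewrite differential0.
Qed.

Lemma is_coboundaryB f f' :
  is_coboundary f -> is_coboundary f' -> is_coboundary (f - f')%R.
Proof.
rewrite /is_coboundary; case: n f f' => [|m]/= f f'.
  by move=> -> ->; rewrite subrr.
move=> [h Ch ->] [h' Ch' ->]; exists (h - h')%R; first exact: familyB.
by rewrite differentialB.
Qed.

Lemma cohomologous_equiv : equiv_class_of
  (fun f f' : cocycle => `[< is_coboundary (sval f - sval f')%R >]).
Proof.
have sym (f f' : cocycle) : is_coboundary (sval f - sval f')%R ->
    is_coboundary (sval f' - sval f)%R.
  by move=> /(is_coboundaryB is_coboundary0); rewrite sub0r opprB.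
split=> [f|f f'|f' f f''].
- by apply/asboolP; rewrite subrr; apply: is_coboundary0.
- by apply/asboolP/asboolP; apply: sym.
move=> /asboolP ff' /asboolP/sym f'f''; apply/asboolP.
by have := is_coboundaryB ff' f'f''; rewrite opprB addrA subrK.
Qed.

Definition cohomologous_equiv_rel := EquivRelPack cohomologous_equiv.

Definition cohomology : Type := {eq_quot cohomologous_equiv_rel}.
HB.instance Definition _ := Choice.on cohomology.
HB.instance Definition _ := EqQuotient.on cohomology.

End Cohomology.

Section DiscreteCohomology.
Variables (G : groupType) (A : gmodule G).

Definition all_cochains : cochain_family A :=
  @CochainFamily G A (fun=> setT) (fun=> I) (fun _ _ _ _ _ => I).

Definition group_cohomology (n : nat) : Type := cohomology all_cochains n.

End DiscreteCohomology.

Section ContinuousCohomology.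
Variables (G : groupType) (A : gmodule (profinite_completion G)).

Definition continuous_cochain (n : nat) : set (cochain A n) :=
  [set f | continuous (f : {ptws 'I_n -> profinite_completion G} ->
                           discrete_topology A)].

Lemma continuous_cochain0 n : continuous_cochain (0%R : cochain A n).
Proof. exact: cst_continuous. Qed.

Lemma continuous_cochainB n (f f' : cochain A n) : continuous_cochain f ->
  continuous_cochain f' -> continuous_cochain (f - f')%R.
Proof.
move=> cf cf' x U /nbhs_singleton Ux.
pose V := {ptws 'I_n -> profinite_completion G}.
have fx : nbhs (x : V) [set y | f y = f x].
  by apply: (cf x [set f x]); apply: (@discrete_set1 (discrete_topology A)).
have f'x : nbhs (x : V) [set y | f' y = f' x].
  by apply: (cf' x [set f' x]); apply: (@discrete_set1 (discrete_topology A)).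
have F : Filter (nbhs (x : V)) by exact: nbhs_filter.
apply: (@filterS _ _ F _ _ _ (@filterI _ _ F _ _ fx f'x)) => y [/= fy f'y].
by rewrite [X in U X]/(f y - f' y)%R fy f'y.
Qed.

Definition continuous_cochains : cochain_family A :=
  CochainFamily continuous_cochain0 continuous_cochainB.

Definition continuous_cohomology (n : nat) : Type :=
  cohomology continuous_cochains n.

End ContinuousCohomology.

Section ComparisonMap.
Variables (G : groupType) (A : gmodule (profinite_completion G)) (n : nat).

Let c : {multiplicative G -> profinite_completion G} := @completion_map G.

Definition restrict_cochain m (f : cochain A m) :
  cochain (restrict_module c A) m := fun g => f (fun j => c (g j)).

Lemma differential_restrict m (f : cochain A m) :
  differential (restrict_cochain f) = restrict_cochain (differential f).
Proof.
apply/funext => g; rewrite /restrict_cochain /differential /=.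
congr (_ + _ + _)%R; apply: eq_bigr => i _; congr (f _ *~ _)%R.
apply/funext => j; rewrite /merge_at.
by case: ifP => // _; case: ifP => // _; rewrite gmulfM.
Qed.

Lemma restrict_cocycleP (f : cocycle (continuous_cochains A) n) :
  `[< is_cocycle (all_cochains (restrict_module c A))
        (restrict_cochain (sval f)) >].
Proof.
apply/asboolP; split=> //; rewrite differential_restrict.
by have /asboolP[_ ->] := svalP f.
Qed.

Definition restrict_cocycle (f : cocycle (continuous_cochains A) n) :
  cocycle (all_cochains (restrict_module c A)) n :=
  exist _ (restrict_cochain (sval f)) (restrict_cocycleP f).

Definition comparison_map (x : continuous_cohomology A n) :
  group_cohomology (restrict_module c A) n :=
  \pi_(cohomology _ n) (restrict_cocycle (repr x)).

Lemma comparison_mapE (f : cocycle (continuous_cochains A) n) :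
  comparison_map (\pi_(cohomology _ n) f) =
  \pi_(cohomology _ n) (restrict_cocycle f).
Proof.
apply/eqmodP/asboolP => /=; set f' := repr _.
have /eqmodP/asboolP : \pi_(cohomology (continuous_cochains A) n) f' = \pi f.
  by rewrite reprK.
rewrite /restrict_cocycle /=; move: (sval f') (sval f); rewrite /is_coboundary.
case: n => [|m] u v /=.
  by move=> /eqP; rewrite subr_eq0 => /eqP ->; rewrite subrr.
move=> [h _ uv]; exists (restrict_cochain h) => //.
by rewrite differential_restrict -uv.
Qed.

End ComparisonMap.

Definition class_A (n : nat) (G : groupType) : Prop :=
  forall A : gmodule (profinite_completion G),
    finite_set [set: A] ->
    continuous (fun p : profinite_completion G * discrete_topology A =>
      gact p.1 (p.2 : A) : discrete_topology A) ->
    (forall i, (i <= n)%N -> bijective (@comparison_map G A i)) /\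
    injective (@comparison_map G A n.+1).

Definition highly_residually_finite (G : groupType) : Prop :=
  residually_finite G /\ class_A 2 G.

(* Main.v *)
From HB Require Import structures.
From mathcomp Require Import all_boot all_algebra perm zify ring.
From mathcomp Require Import mathcomp_extra boolp classical_sets functions.
From mathcomp Require Import cardinality filter topology.
From mathcomp.multinomials Require mpoly.
Require Import Defs.

(* Residual finiteness follows Borisov and Sapir. An element of G_phi that is not
   conjugate into G is detected by the exponent sum of t modulo some m. For g <> 1
   in G, free on x_1, ..., x_k, let f be the polynomial self-map of k-tuples of
   2x2 matrices given by A |-> (phi(x_i)(A))_i, with adjugates for inverses. If A
   is a point over a finite domain with f(A) = A^(Q), the entrywise Q-th powers for
   a power Q of p, with det A_i <> 0 and g(A) not scalar, then G_phi acts on 2x2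
   matrices, x_i by conjugation with A_i and t by the Frobenius, and g acts
   nontrivially. To find A, let I be the ideal of all x_i^Q - f_i in
   F_p[x_1, ..., x_n]; modulo I the substitution F : x_i |-> f_i is the Q-th power
   map. An algebraic relation between x_i, F(x_i), ..., F^n(x_i) becomes modulo I
   an equation for x_i of degree at most C Q^n, with C independent of Q, and this
   bounds nilpotency indices: if D is nilpotent modulo I, then F^n(D)^K is in I for
   a K independent of Q. But I contains no nonzero polynomial of degree less than
   Q, so F^n(D) = 0. The D expressing the conditions on A is excluded by a faithful
   representation of G in SL_2(F_p[t]).

   For the class A_2, compactness identifies the continuous cochains with those
   that factor through a finite quotient. A 2-cocycle with values in a finite
   module A defines an extension E of G_phi; conjugation by a lift of t and
   composition with phi act on the finite set of lifts of G to E, and a lift of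
   period m splits the extension after A is enlarged to the functions Z/m -> A.
   Hence the cocycle is cohomologous to one that factors through a finite quotient.
   Injectivity in degree 3 follows by dimension shifting. *)

Set Implicit Arguments.
Unset Strict Implicit.
Unset Printing Implicit Defensive.

(** * Prime ideals avoiding the powers of an element *)

Section PrimeAvoidance.
Import GRing.Theory.
Local Open Scope ring_scope.
Local Open Scope quotient_scope.
Local Open Scope classical_set_scope.
Variable R : comNzRingType.

Definition ideal (I : set R) : Prop :=
  [/\ I 0, forall x y, I x -> I y -> I (x + y) & forall a x, I x -> I (a * x)].

Lemma ideal_adjoin (I : set R) x : ideal I ->
  ideal [set z | exists2 a, I a & exists b, z = a + b * x].
Proof.
move=> [I0 ID IM]; split=> [|_ _ [a Ia [b ->]] [c Ic [d ->]]|e _ [a Ia [b ->]]].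
- by exists 0 => //; exists 0; rewrite mul0r addr0.
- by exists (a + c); [exact: ID|exists (b + d); rewrite mulrDl addrACA].
- by exists (e * a); [exact: IM|exists (e * b); rewrite mulrDr mulrA].
Qed.

Lemma ideal_quotient (I : set R) : ideal I -> ~ I 1 ->
  exists (S : comNzRingType) (h : {rmorphism R -> S}),
    (forall z, exists x, z = h x) /\ (forall x, h x = 0 <-> I x).
Proof.
move=> Ii I1; pose P : {pred R} := fun x => `[< I x >].
have Pc : idealr_closed P.
  case: (Ii) => I0 IDD IM; split=> [||a x y /asboolP Ix /asboolP Iy].
  - exact/asboolP.
  - exact/asboolP.
  - by apply/asboolP; apply: IDD => //; apply: IM.
pose K : idealr R := HB.pack P (isIdealr.Build R P Pc).
have KE x : (\pi_{ideal_quot K} x == 0) = (x \in K).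
  by rewrite -(rmorph0 \pi_{ideal_quot K}) -Quotient.idealrBE subr0.
exists {ideal_quot K}, \pi; split; first by move=> z; exists (repr z); rewrite /= reprK.
by move=> x; split=> [/eqP|Ix]; [rewrite KE => /asboolP|apply/eqP; rewrite KE; apply/asboolP].
Qed.

Variables (I : set R) (D : R).
Hypothesis Iideal : ideal I.
Hypothesis ID : forall s, ~ I (D ^+ s).

(** An ideal maximal among those that contain [I] and no power of [D] is prime: if neither [x] nor
    [y] lies in it, adjoining either one captures a power of [D], and the product of these two
    powers lies in the ideal as soon as [x * y] does. *)
Lemma prime_ideal_avoiding : exists J : set R,
  [/\ ideal J, I `<=` J, forall s, ~ J (D ^+ s) &
      forall x y, J (x * y) -> J x \/ J y].
Proof.
pose avoids (J : set R) := ideal J /\ forall s, ~ J (D ^+ s).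
(* The predicate constrains the union of [I] with the set, so that the union of an empty chain
   satisfies it as well. *)
have [F FP tF|A [[Ai AD] maxA]] :=
    @Zorn_bigcup R (fun J => avoids (I `|` J)).
  have tot J J' : F J -> F J' -> exists K, [/\ F K, J `<=` K & J' `<=` K].
    by move=> FJ FJ'; case: (tF J J' FJ FJ') => H;
      [exists J'|exists J]; split.
  split; last first.
    by move=> s [/ID//|[J /FP[_ JD] Js]]; apply: (JD s); right.
  split; first by left; case: Iideal.
    have key x y J : F J -> (I `|` J) x -> (I `|` J) y ->
        (I `|` \bigcup_(X in F) X) (x + y).
      move=> FJ Jx Jy; have [[_ JD _] _] := FP J FJ.
      by case: (JD _ _ Jx Jy) => H; [left|right; exists J].
    move=> x y [Ix|[J FJ Jx]] [Iy|[J' FJ' J'y]].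
    - by left; case: Iideal => _ + _; apply.
    - by apply: (key _ _ J') => //; [left|right].
    - by apply: (key _ _ J) => //; [right|left].
    - have [K [FK JK J'K]] := tot _ _ FJ FJ'.
      by apply: (key _ _ K) => //; right; [exact: JK|exact: J'K].
  move=> a x [Ix|[J FJ Jx]]; first by left; case: Iideal => _ _; apply.
  have [[_ _ JM] _] := FP J FJ.
  by case: (JM a x (or_intror Jx)) => H; [left|right; exists J].
exists (I `|` A); split => // x y Axy; apply: contrapT.
move=> /not_orP[nAx nAy].
have key z : ~ (I `|` A) z ->
    exists s a b, (I `|` A) a /\ D ^+ s = a + b * z.
  move=> nAz; pose J := [set w | exists2 a, (I `|` A) a & exists b, w = a + b * z].
  have Ji : ideal J by exact: ideal_adjoin.
  have AJ : I `|` A `<=` J.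
    by move=> w Aw; exists w => //; exists 0; rewrite mul0r addr0.
  have Jz : J z by exists 0; [case: Ai|exists 1; rewrite mul1r add0r].
  have /maxA : A `<` J.
    split; first by move=> w Aw; apply: AJ; right.
    by move=> JA; apply: nAz; right; apply: JA.
  have IJ : I `|` J = J.
    by apply/seteqP; split=> [w [Iw|//]|w]; [apply: AJ; left|right].
  rewrite IJ => /not_andP[//|/existsNP[s /contrapT[a Aa [b Hb]]]].
  by exists s, a, b.
have [s [a [b [Aa sE]]]] := key _ nAx.
have [t [c [d [Ac tE]]]] := key _ nAy.
apply: (AD (s + t)%N); rewrite exprD sE tE mulrDl 2!mulrDr.
case: Ai => _ AD' AM; apply: (AD').
  by apply: AD'; [apply: AM|rewrite mulrC; apply: AM].
by apply: AD'; [apply: AM|rewrite mulrACA; apply: AM].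
Qed.

Lemma domain_quotient_avoiding : exists (S : comNzRingType) (h : {rmorphism R -> S}),
  [/\ forall z, exists x, z = h x, forall x, I x -> h x = 0, h D != 0 &
      forall x y : S, x * y = 0 -> x = 0 \/ y = 0].
Proof.
have [J [Ji IJ JD Jp]] := prime_ideal_avoiding.
have J1 : ~ J 1 by have := JD 0%N; rewrite expr0.
have [S [h [hS hJ]]] := ideal_quotient Ji J1; exists S, h; split=> //.
- by move=> x /IJ /hJ.
- by apply/eqP => /hJ; have := JD 1%N; rewrite expr1.
move=> x y; have [a ->] := hS x; have [b ->] := hS y.
by rewrite -rmorphM => /hJ /Jp [] /hJ; [left|right].
Qed.

End PrimeAvoidance.

(** * Frobenius powers and univariate polynomials *)

Section UnivariateNilpotency.
Import GRing.Theory.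
Local Open Scope ring_scope.

(** Every irreducible factor of [P] divides [Z] and occurs at most [deg P] times in [P]. The
    induction removes [gcdp P Z], which is nonconstant unless [P] is a unit. *)
Lemma dvdp_exp_size (F : fieldType) (P Z : {poly F}) (N : nat) :
  P != 0 -> P %| Z ^+ N -> P %| Z ^+ (size P).-1.
Proof.
have [s] := ubnP (size P); elim: s P => // s IHs P /ltnSE sP P0 PZ.
have gP : gcdp P Z %| P := dvdp_gcdl P Z.
have g0 : gcdp P Z != 0 by apply: contraNneq P0 => g0; move: gP; rewrite g0 dvd0p.
have [co|nco] := boolP (coprimep P Z).
  have : P %| 1 by rewrite -(Gauss_dvdpl 1 (coprimep_expr N co)) mul1r.
  by move=> P1; move: (P1); rewrite dvdp1 => /eqP ->; rewrite expr0.
pose P' := P %/ gcdp P Z; have PE : P' * gcdp P Z = P by exact: divpK.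
have P'0 : P' != 0 by apply: contraNneq P0 => P'0; rewrite -PE P'0 mul0r.
have sg : (1 < size (gcdp P Z))%N.
  by move: nco; rewrite /coprimep; move: g0; rewrite -size_poly_eq0; lia.
have sE : size P = (size P' + size (gcdp P Z)).-1 by rewrite -[in LHS]PE size_mul.
have sP' : (0 < size P')%N by rewrite lt0n size_poly_eq0.
have P'Z : P' %| Z ^+ (size P').-1.
  apply: IHs => //; last first.
    by apply: dvdp_trans PZ; rewrite -PE dvdp_mulr.
  move: sP sg sP'; rewrite sE; clear.
  by case: (size P') => // ?; case: (size (gcdp _ _)) => //= ?; lia.
rewrite -[X in X %| _]PE (@dvdp_trans _ (Z ^+ (size P').-1 * Z)) //.
  by rewrite dvdp_mul // dvdp_gcdr.
by rewrite -exprSr dvdp_exp2l //; lia.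
Qed.

Lemma nat_fintype_collision (T : finType) (f : nat -> T) :
  exists i j, (i < j)%N /\ f i = f j.
Proof.
have : ~~ injectiveb (fun i : 'I_#|T|.+1 => f i).
  by apply/injectiveP => /leq_card; rewrite card_ord ltnn.
case/injectivePn => i [j ij fij].
case: (ltngtP i j) => [lt|gt|/val_inj eq]; last by rewrite eq eqxx in ij.
- by exists i, j.
- by exists j, i.
Qed.

Section FrobeniusPower.
Variables (C : comNzRingType) (p : nat).
Hypothesis pC : p \in [pchar C].

(** The characteristic enters as an argument so that the ring morphism instances below can be
    attached to the map. *)
Definition frobenius of p \in [pchar C] := fun (k : nat) (x : C) => x ^+ (p ^ k).

Lemma frobenius_zmod_morphism k : zmod_morphism (frobenius pC k).
Proof.
have pk : [pchar C].-nat (p ^ k)%N by rewrite pnatX (pnatE _ (pcharf_prime pC)) pC.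
by move=> x y; rewrite /frobenius exprDn_pchar // exprNn_pchar.
Qed.

Lemma frobenius_monoid_morphism k : monoid_morphism (frobenius pC k).
Proof. by split=> [|x y]; rewrite /frobenius ?expr1n // exprMn. Qed.

HB.instance Definition _ k :=
  GRing.isZmodMorphism.Build C C (frobenius pC k) (frobenius_zmod_morphism k).
HB.instance Definition _ k :=
  GRing.isMonoidMorphism.Build C C (frobenius pC k) (frobenius_monoid_morphism k).

Lemma frobeniusE k x : frobenius pC k x = x ^+ (p ^ k). Proof. by []. Qed.

Lemma frobeniusB k (x y : C) : (x - y) ^+ (p ^ k) = x ^+ (p ^ k) - y ^+ (p ^ k).
Proof. exact: (rmorphB (frobenius pC k)). Qed.

End FrobeniusPower.

(** There are finitely many residues modulo [P], so [X^(p^i)] and [X^(p^j)] agree for some [i < j].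
    Their difference is the [p^i]-th power of [X^(p^(j-i)) - X], and [dvdp_exp_size] brings the
    exponent down to [deg P]. *)
Lemma dvdp_frobenius_sub (p : nat) (P : {poly 'F_p}) : prime p -> P != 0 ->
  exists M, P %| ('X^(p ^ M.+1) - 'X) ^+ (size P).-1.
Proof.
move=> p_pr P0.
have pc : p \in [pchar {poly 'F_p}] by rewrite (rmorph_pchar (@polyC 'F_p)) // pchar_Fp.
have [i [j [ij E]]] := nat_fintype_collision
  (fun k => poly_rV ('X^(p ^ k) %% P) : 'rV['F_p]_(size P)).
have {}E : P %| 'X^(p ^ j) - 'X^(p ^ i).
  have sm k : (size ('X^(p ^ k) %% P)%R <= size P)%N by rewrite ltnW // ltn_modp.
  move/(congr1 rVpoly): E; rewrite !poly_rV_K // => E.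
  by rewrite /dvdp modpD modpN E subrr.
exists (j - i).-1; apply: (@dvdp_exp_size _ _ _ (p ^ i)) => //.
rewrite prednK ?subn_gt0 //.
have -> : ('X^(p ^ (j - i)) - 'X) ^+ (p ^ i) = 'X^(p ^ j) - 'X^(p ^ i) :> {poly 'F_p}.
  by rewrite frobeniusB // -exprM -expnD subnK // ltnW.
by [].
Qed.
End UnivariateNilpotency.

(** * The ideal generated by the power gaps *)

Section MsizeBounds.
Import GRing.Theory mpoly.
Local Open Scope ring_scope.
Variables (R : comNzRingType) (n : nat).
Local Notation B := {mpoly R[n]}.

Lemma msize_sum_le (I : Type) (r : seq I) (P : pred I) (F : I -> B) d :
  (forall i, P i -> (msize (F i) <= d)%N) -> (msize (\sum_(i <- r | P i) F i) <= d)%N.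
Proof.
move=> Fd; elim/big_ind: _ => [||//]; first by rewrite msize0.
by move=> x y xd yd; rewrite (leq_trans (msizeD_le _ _)) // geq_max xd.
Qed.

Lemma msizeM_pred (p q : B) : (msize (p * q) <= (msize p + msize q).-1)%N.
Proof.
have [->|p0] := eqVneq p 0; first by rewrite mul0r msize0.
have [->|q0] := eqVneq q 0; first by rewrite mulr0 msize0.
have [->|pq0] := eqVneq (p * q) 0; first by rewrite msize0.
rewrite -!mlead_deg // addSn addnS /= ltnS.
by have /lemc_mdeg := mleadM_le p q; rewrite mdegD.
Qed.

Lemma msize_exp_le (u : B) k : (msize (u ^+ k) <= ((msize u).-1 * k).+1)%N.
Proof.
elim: k => [|k IHk]; first by rewrite expr0 msize1.
rewrite exprS mulnS (leq_trans (msizeM_pred _ _)) //.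
by move: (msize u) (msize (u ^+ k)) IHk => x y; lia.
Qed.

End MsizeBounds.

Section LeadingPowers.
Import GRing.Theory mpoly.
Local Open Scope ring_scope.
Variables (R : comNzRingType) (n Q : nat) (f : 'I_n -> {mpoly R[n]}).
Hypothesis Q_gt0 : (0 < Q)%N.
Hypothesis fQ : forall i, (msize (f i) <= Q)%N.
Local Notation B := {mpoly R[n]}.
Local Notation mon := 'X_{1..n}.

Definition power_gap i : B := 'X_i ^+ Q - f i.

(** As [msize] is the degree plus one, the bound says that [u] is [X^m] plus terms of degree less
    than that of [m]. *)
Definition monic_in (u : B) (m : mon) := (msize (u - 'X_[m]) <= mdeg m)%N.

Lemma monic_in1 : monic_in 1 0%MM.
Proof. by rewrite /monic_in mpolyX0 subrr msize0. Qed.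

Lemma msize_monic_in u m : monic_in u m -> (msize u <= (mdeg m).+1)%N.
Proof.
move=> um; rewrite -[u](subrK 'X_[m]) (leq_trans (msizeD_le _ _)) // geq_max.
by rewrite msizeX leqnn andbT (leq_trans um).
Qed.

Lemma monic_inM u v m m' : monic_in u m -> monic_in v m' -> monic_in (u * v) (m + m')%MM.
Proof.
move=> um vm; rewrite /monic_in mpolyXD mdegD.
have -> : u * v - 'X_[m] * 'X_[m'] = (u - 'X_[m]) * v + 'X_[m] * (v - 'X_[m']).
  by rewrite mulrBl mulrBr addrA subrK.
rewrite (leq_trans (msizeD_le _ _)) // geq_max.
have s1 := msizeM_pred (u - 'X_[m]) v; have s2 := msizeM_pred 'X_[m] (v - 'X_[m']).
have vs := msize_monic_in vm; have := msizeX R m; move: um vm; rewrite /monic_in.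
move: s1 s2 vs; set a := msize _; set b := msize _; set c := msize _.
set d := msize _; set e := msize _; set g := msize _; lia.
Qed.

Lemma monic_in_exp u m k : monic_in u m -> monic_in (u ^+ k) (m *+ k)%MM.
Proof.
move=> um; elim: k => [|k IHk]; first by rewrite mulm0n; exact: monic_in1.
by rewrite exprS mulmS; exact: monic_inM.
Qed.

Lemma monic_in_prod (I : Type) (r : seq I) (F : I -> B) (m : I -> mon) :
  (forall i, monic_in (F i) (m i)) ->
  monic_in (\prod_(i <- r) F i) (\sum_(i <- r) m i)%MM.
Proof.
move=> Fm; elim: r => [|i r IHr]; first by rewrite !big_nil; exact: monic_in1.
by rewrite !big_cons; exact: monic_inM.
Qed.

Lemma monic_in_power_gap i : monic_in (power_gap i) (U_(i) *+ Q)%MM.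
Proof.
rewrite /monic_in /power_gap mpolyXn addrAC subrr add0r msizeN mdegMn mdeg1 mul1n.
exact: fQ.
Qed.

(** Each factor [X_i^Q] of the monomial is replaced by [X_i^Q - f_i]. The results differ from the
    monomials only in lower degree, so they form another basis of the polynomial ring. *)
Definition digits (m : mon) : B :=
  'X_[[multinom (m i %% Q)%N | i < n]] * \prod_i power_gap i ^+ (m i %/ Q).

Lemma monic_in_digits m : monic_in (digits m) m.
Proof.
have {2}-> : m = ([multinom (m i %% Q)%N | i < n] + \sum_i (U_(i) *+ Q) *+ (m i %/ Q))%MM.
  apply/mnmP => j; rewrite mnmDE mnmE mnm_sumE (bigD1 j) //= big1.
    by rewrite addn0 !mulmnE mnm1E eqxx; have := divn_eq (m j) Q; lia.
  by move=> i ij; rewrite !mulmnE mnm1E (negbTE ij).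
apply: monic_inM; first by rewrite /monic_in subrr msize0.
by apply: monic_in_prod => i; apply: monic_in_exp; apply: monic_in_power_gap.
Qed.

Lemma digits_small (m : mon) : (forall i, m i < Q)%N -> digits m = 'X_[m].
Proof.
move=> mQ; rewrite /digits big1 ?mulr1 => [|i _]; last by rewrite divn_small.
by congr 'X_[_]; apply/mnmP => i; rewrite mnmE modn_small.
Qed.

Lemma digits_carry i (m : mon) : digits (m + U_(i) *+ Q)%MM = power_gap i * digits m.
Proof.
rewrite /digits mulrCA; congr ('X_[_] * _).
  apply/mnmP => j; rewrite !mnmE !mulmnE mnm1E.
  by case: eqP; rewrite ?mul1n ?mul0n ?addn0 // modnDr.
rewrite (bigD1 i) //= [in RHS](bigD1 i) //= mulrA -exprS mnmDE mulmnE mnm1E eqxx mul1n.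
rewrite divnDr // divnn Q_gt0 addn1; congr (_ * _).
by apply: eq_bigr => j ji; rewrite mnmDE mulmnE mnm1E eq_sym (negbTE ji) mul0n addn0.
Qed.

(* Truncated at degree [k], where it is the linear map replacing each monomial
   [X^m] by the product [digits m]. *)
Definition digit_map (k : nat) (u : B) : B := \sum_(m : 'X_{1..n < k}) u@_m *: digits m.

Lemma digit_map_is_linear k : linear (digit_map k).
Proof.
move=> a u v; rewrite /digit_map scaler_sumr -big_split /=; apply: eq_bigr => m _.
by rewrite mcoeffD mcoeffZ scalerDl scalerA.
Qed.
HB.instance Definition _ k := GRing.isLinear.Build R B B _ (digit_map k) (digit_map_is_linear k).

Lemma digit_mapX k (m : mon) : (mdeg m < k)%N -> digit_map k 'X_[m] = digits m.
Proof.
move=> mk; rewrite /digit_map (bigD1 (BMultinom mk)) //= mcoeffX eqxx scale1r.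
rewrite big1 ?addr0 // => m' /negbTE mm'; rewrite mcoeffX eq_sym.
by rewrite -[m]/(val (BMultinom mk)) (inj_eq val_inj) mm' scale0r.
Qed.

Lemma msize_digit_map_sub k u : (msize u <= k)%N -> (msize (digit_map k u - u)%R <= (msize u).-1)%N.
Proof.
move=> uk; rewrite [X in _ - X](mpolywE uk) -sumrB; apply: msize_sum_le => m _.
rewrite -scalerBr; have [->|um] := eqVneq u@_m 0; first by rewrite scale0r msize0.
rewrite (leq_trans (msizeZ_le _ _)) // (leq_trans (monic_in_digits m)) //.
have : val m \in msupp u by rewrite mcoeff_msupp.
by move/msize_mdeg_lt; case: (msize u).
Qed.

Lemma digit_map_inj k u : (msize u <= k)%N -> digit_map k u = 0 -> u = 0.
Proof.
move=> uk u0; have := msize_digit_map_sub uk; rewrite u0 sub0r msizeN => su.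
by apply/eqP; rewrite -msize_poly_eq0; lia.
Qed.

(** The error [digit_map k u - u] has smaller degree than [u] and is corrected by induction. *)
Lemma digit_map_surj k u : (msize u <= k)%N ->
  exists2 v, (msize v <= msize u)%N & digit_map k v = u.
Proof.
have [s] := ubnP (msize u); elim: s u => // s IHs u us uk.
have [->|u0] := eqVneq u 0; first by exists 0; rewrite ?linear0.
have su : (0 < msize u)%N by rewrite lt0n msize_poly_eq0.
have ds := msize_digit_map_sub uk.
have [||v vs vE] := IHs (digit_map k u - u); [lia|lia|].
exists (u - v); last by rewrite linearB /= vE opprB addrC subrK.
by rewrite (leq_trans (msizeD_le _ _)) // geq_max leqnn msizeN; lia.
Qed.

(** By [digits_carry], multiplication by the [i]-th power gap corresponds under [digit_map] to
    multiplication by [X_i^Q]. Hence [u] is the image of some [w = sum v_i X_i^Q]. Since [digit_map]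
    fixes polynomials of degree less than [Q], injectivity gives [u = w], while all monomials of [w]
    have degree at least [Q]. *)
Lemma power_gap_comb_small (c : 'I_n -> B) u :
  u = \sum_i c i * power_gap i -> (msize u <= Q)%N -> u = 0.
Proof.
(* [k] exceeds all degrees that occur, so the truncation in [digit_map] has no effect. *)
move=> uE uQ; pose k := ((\max_i msize (c i)) + Q + 1)%N.
have ck i : (msize (c i) + Q < k)%N.
  by rewrite /k addn1 ltnS leq_add2r (leq_bigmax i).
have uk : (msize u <= k)%N by rewrite /k; lia.
have [v vP] : exists v : 'I_n -> B,
    forall i, (msize (v i) <= msize (c i))%N /\ digit_map k (v i) = c i.
  apply: (@fin_all_exists _ (fun=> B)
    (fun i w => (msize w <= msize (c i))%N /\ digit_map k w = c i)) => i.
  by have [|w] := @digit_map_surj k (c i); [have := ck i; lia|exists w].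
have small (m : mon) i : (mdeg m < Q)%N -> (m i < Q)%N.
  by apply: leq_ltn_trans; rewrite mdegE (bigD1 i) //= leq_addr.
have uE' : digit_map k u = u.
  rewrite [RHS](mpolywE uk) /digit_map; apply: eq_bigr => m _.
  have [->|um] := eqVneq u@_m 0; first by rewrite !scale0r.
  rewrite digits_small // => i; apply: small.
  have : val m \in msupp u by rewrite mcoeff_msupp.
  by move=> /msize_mdeg_lt mu; apply: leq_trans uQ.
pose w := \sum_i v i * 'X_i ^+ Q.
have wk : (msize w <= k)%N.
  apply: msize_sum_le => i _; rewrite (leq_trans (msizeM_pred _ _)) // mpolyXn msizeX.
  by rewrite mdegMn mdeg1 mul1n; have := ck i; have [] := vP i; lia.
have wE : digit_map k w = u.
  rewrite /w linear_sum uE; apply: eq_bigr => i _.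
  have [vs <-] := vP i; have vk : (msize (v i) <= k - Q)%N by have := ck i; lia.
  rewrite [in LHS](mpolywE vk) [in RHS](mpolywE vk) mulr_suml linear_sum /=.
  rewrite linear_sum mulr_suml /=; apply: eq_bigr => m _.
  have mk : (mdeg m + Q < k)%N by have := bmdeg m; have := ck i; lia.
  rewrite -scalerAl mpolyXn -mpolyXD !linearZ /= -scalerAl digit_mapX; last first.
    by rewrite mdegD mdegMn mdeg1 mul1n.
  by rewrite digit_mapX; [rewrite digits_carry mulrC|lia].
have uw : u = w.
  apply/eqP; rewrite -subr_eq0; apply/eqP/(@digit_map_inj k).
    by rewrite (leq_trans (msizeD_le _ _)) // geq_max uk msizeN wk.
  by rewrite linearB /= uE' wE subrr.
apply/mpolyP => m; rewrite mcoeff0; have [mQ|mQ] := ltnP (mdeg m) Q; last first.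
  by apply/eqP; rewrite mcoeff_eq0 msize_mdeg_ge // (leq_trans uQ).
rewrite uw /w raddf_sum big1 //= => i _; rewrite [v i]mpolyE mulr_suml raddf_sum big1 //=.
move=> m' _; rewrite -scalerAl mcoeffZ mpolyXn -mpolyXD mcoeffX.
case: eqP => [E|_]; last by rewrite mulr0.
by have := small m i mQ; rewrite -E mnmDE mulmnE mnm1E eqxx mul1n; lia.
Qed.

(** A basis element [digits m] with some [m i >= Q] has a power gap as a factor and dies in [S];
    there remain the monomials with all exponents below [Q]. *)
Lemma finite_of_power_gap (S : comNzRingType) (h : {rmorphism B -> S}) :
  (forall i, h (power_gap i) = 0) ->
  forall u, exists c : {ffun {ffun 'I_n -> 'I_Q} -> R},
    h u = \sum_a h (c a)%:MP * \prod_i h 'X_i ^+ a i.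
Proof.
move=> h0 u; have [v _ <-] := digit_map_surj (leqnn (msize u)).
rewrite raddf_sum; elim/big_ind: _ => [|_ _ [c ->] [d ->]|m _].
- exists [ffun=> 0]; rewrite big1 // => a _.
  by rewrite ffunE mpolyC0 rmorph0 mul0r.
- exists [ffun a => c a + d a]; rewrite -big_split; apply: eq_bigr => a _ /=.
  by rewrite ffunE mpolyCD rmorphD mulrDl.
have [mQ|/forallPn/=[i mi]] := boolP [forall i, m i < Q]%N; last first.
  exists [ffun=> 0]; rewrite big1 => [|a _].
    rewrite -mul_mpolyC rmorphM /digits rmorphM rmorph_prod (bigD1 i) //= rmorphXn h0.
    by rewrite expr0n eqn0Ngt divn_gt0 // leqNgt mi mul0r !mulr0.
  by rewrite ffunE mpolyC0 rmorph0 mul0r.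
have {}mQ i : (m i < Q)%N by have /forallP := mQ.
pose b : {ffun 'I_n -> 'I_Q} := [ffun i => Ordinal (mQ i)].
exists [ffun a => if a == b then v@_m else 0].
rewrite (bigD1 b) //= [X in _ + X]big1 ?addr0 => [|a ab]; last first.
  by rewrite ffunE (negbTE ab) mpolyC0 rmorph0 mul0r.
rewrite [X in X%:MP]ffunE eqxx digits_small // -mul_mpolyC rmorphM; congr (_ * _).
rewrite mpolyXE_id rmorph_prod; apply: eq_bigr => i _.
by rewrite rmorphXn ffunE.
Qed.

End LeadingPowers.

(** * Quasi-fixed points of polynomial maps *)

Section QuasiFixedPoints.
Import GRing.Theory mpoly.
Local Open Scope ring_scope.

Lemma base_digits_inj (k Q : nat) (a a' : 'I_k -> nat) :
  (forall j, a j < Q)%N -> (forall j, a' j < Q)%N ->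
  (\sum_j a j * Q ^ j = \sum_j a' j * Q ^ j)%N -> a =1 a'.
Proof.
elim: k a a' => [|k IHk] a a' aQ a'Q; first by move=> _ [].
have split_digit (b : 'I_k.+1 -> nat) :
    (\sum_j b j * Q ^ j = (\sum_j b (lift ord0 j) * Q ^ j) * Q + b ord0)%N.
  rewrite big_ord_recl expn0 muln1 addnC big_distrl /=; congr (_ + _)%N.
  by apply: eq_bigr => j _; rewrite /bump /= add1n expnSr mulnA.
rewrite !split_digit => E.
have E0 : a ord0 = a' ord0.
  by have := congr1 (modn^~ Q) E; rewrite !modnMDl !modn_small.
have {}E : (\sum_j a (lift ord0 j) * Q ^ j = \sum_j a' (lift ord0 j) * Q ^ j)%N.
  have Q0 : (0 < Q)%N := leq_ltn_trans (leq0n _) (aQ ord0).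
  by apply/eqP; move/eqP: E; rewrite E0 eqn_add2r eqn_pmul2r.
move=> j; have [i ->|->//] := unliftP ord0 j.
exact: (IHk (fun i => a (lift ord0 i)) (fun i => a' (lift ord0 i))).
Qed.

Variable p : nat.
Hypothesis p_pr : prime p.

Lemma FpE (c : 'F_p) : c = (c : nat)%:R.
Proof. by rewrite natr_Zp. Qed.

Lemma mpoly_rmorph_ext (n : nat) (C : comNzRingType)
  (g h : {rmorphism {mpoly 'F_p[n]} -> C}) :
  (forall i, g 'X_i = h 'X_i) -> g =1 h.
Proof.
move=> gh u; rewrite [u]mpolyE !rmorph_sum; apply: eq_bigr => m _.
rewrite -mul_mpolyC !rmorphM; congr (_ * _).
  by rewrite [u@_m]FpE mpolyC_nat !rmorph_nat.
by rewrite mpolyXE_id !rmorph_prod; apply: eq_bigr => i _; rewrite !rmorphXn gh.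
Qed.

Variable n : nat.
Local Notation B := {mpoly 'F_p[n]}.

(** The [b^(n+1)] products involve at most [L^n] monomials, and the bound on [b] gives
    [L^n < b^(n+1)]. Over the finite field, counting combinations against coefficient families makes
    two combinations coincide. *)
Lemma algebraic_dependence (g : 'I_n.+1 -> B) (d b : nat) :
  (forall j, msize (g j) <= d.+1)%N -> ((n.+1 * d).+1 ^ n < b)%N ->
  exists2 c : {ffun {ffun 'I_n.+1 -> 'I_b} -> 'F_p}, c != 0 &
    \sum_a c a *: \prod_j g j ^+ a j = 0.
Proof.
move=> gd nb; pose L := (n.+1 * d * b).+1.
have b0 : (0 < b)%N := leq_ltn_trans (leq0n _) nb.
have term_size (a : {ffun 'I_n.+1 -> 'I_b}) : (msize (\prod_j g j ^+ a j)%R <= L)%N.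
  have mulS u v e e' : (msize u <= e.+1)%N -> (msize v <= e'.+1)%N ->
      (msize (u * v : B) <= (e + e').+1)%N.
    move=> ue ve; rewrite (leq_trans (msizeM_pred _ _)) //.
    by move: (msize u) (msize v) ue ve => x y; lia.
  have expS (u : B) e k : (msize u <= e.+1)%N -> (msize (u ^+ k) <= (e * k).+1)%N.
    move=> ue; rewrite (leq_trans (msize_exp_le _ _)) // ltnS leq_mul2r.
    by case: (msize u) ue => [|x] /=; [rewrite orbT|rewrite ltnS => ->; rewrite orbT].
  have : (msize (\prod_j g j ^+ a j)%R <= (\sum_(j < n.+1) d * a j).+1)%N.
    apply: (big_rec2 (fun (u : B) e => msize u <= e.+1)%N); first by rewrite msize1.
    by move=> j e u _ ue; apply: mulS => //; apply: expS.
  move/leq_trans; apply; rewrite ltnS -mulnA.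
  have -> : (n.+1 * (d * b) = \sum_(j < n.+1) d * b)%N by rewrite sum_nat_const card_ord.
  by apply: leq_sum => j _; rewrite leq_mul2l ltnW ?orbT.
pose comb (c : {ffun {ffun 'I_n.+1 -> 'I_b} -> 'F_p}) := \sum_a c a *: \prod_j g j ^+ a j.
have comb_size c : (msize (comb c) <= L)%N.
  by apply: msize_sum_le => a _; rewrite (leq_trans (msizeZ_le _ _)).
pose coefs c : {ffun {ffun 'I_n -> 'I_L} -> 'F_p} :=
  [ffun a : {ffun 'I_n -> 'I_L} => (comb c)@_[multinom (a i : nat) | i < n]].
have : ~~ injectiveb coefs.
  apply/injectiveP => /leq_card; rewrite !card_ffun !card_ord leqNgt => /negP; apply.
  have p1 : (1 < #|'F_p|)%N by rewrite card_Fp // prime_gt1.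
  rewrite ltn_exp2l // (@leq_ltn_trans (((n.+1 * d).+1 * b) ^ n)%N) //.
    have LE : (L <= (n.+1 * d).+1 * b)%N by rewrite /L mulSn; lia.
    by have [->|n0] := posnP n; rewrite ?expn0 // leq_exp2r.
  by rewrite expnMn expnSr mulnC ltn_pmul2l // expn_gt0 b0.
case/injectivePn => c [c' cc' E]; exists (c - c'); first by rewrite subr_eq0.
have -> : \sum_a (c - c') a *: \prod_j g j ^+ a j = comb c - comb c'.
  rewrite /comb -sumrB; apply: eq_bigr => a _.
  by rewrite ffunE [(- c') a]ffunE scalerBl.
apply/eqP; rewrite subr_eq0; apply/eqP/mpolyP => m.
have [mL|Lm] := ltnP (mdeg m) L; last first.
  rewrite !(memN_msupp_eq0 (msize_mdeg_ge _)) // (leq_trans _ Lm) //.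
have mi i : (m i < L)%N.
  by apply: leq_ltn_trans mL; rewrite mdegE (bigD1 i) //= leq_addr.
move/ffunP/(_ [ffun i => Ordinal (mi i)]): E; rewrite !ffunE.
suff -> : [multinom ([ffun i => Ordinal (mi i)] i : nat) | i < n] = m by [].
by apply/mnmP => i; rewrite mnmE ffunE.
Qed.

Lemma Fp_pchar_image (C : comNzRingType) (h : {rmorphism 'F_p -> C}) : p \in [pchar C].
Proof. by apply: (rmorph_pchar h); exact: pchar_Fp. Qed.

Variable f : 'I_n -> B.
Let F : {rmorphism B -> B} := mmap (@mpolyC n 'F_p) f.

Let F_X i : F 'X_i = f i. Proof. by rewrite /F /= mmapX mmap1U. Qed.

(** [P] arises from an algebraic relation by substituting [x^(Q^j)] for the [j]-th argument. Since
    [b <= Q], distinct exponent vectors are distinct expansions in base [Q], so no terms cancel. *)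
Lemma exponent_polynomial (b Q : nat) (c : {ffun {ffun 'I_n.+1 -> 'I_b} -> 'F_p}) :
  c != 0 -> (b <= Q)%N ->
  let P := \sum_a c a *: 'X^(\sum_j a j * Q ^ j) : {poly 'F_p} in
  P != 0 /\ (size P <= (n.+1 * b * Q ^ n).+1)%N.
Proof.
move=> c0 bQ P; have aQ (a : {ffun 'I_n.+1 -> 'I_b}) j : (a j < Q)%N.
  exact: leq_trans (ltn_ord _) bQ.
split.
  have [a ca] : exists a, c a != 0.
    by apply/existsP; apply: contraNT c0 => /existsPn c0; apply/eqP/ffunP => a;
      rewrite ffunE; apply/eqP; have := c0 a; rewrite negbK.
  apply: contraNneq ca => P0; have := congr1 (fun q : {poly _} => q`_(\sum_j a j * Q ^ j)) P0.
  rewrite coef0 /P coef_sum (bigD1 a) //= coefZ coefXn eqxx mulr1 big1 ?addr0 => [->//|a' a'a].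
  rewrite coefZ coefXn; case: eqP => [E|_]; last by rewrite mulr0.
  case/eqP: a'a; apply/ffunP => j; apply/val_inj.
  exact: (base_digits_inj (aQ a') (aQ a) (esym E)).
rewrite (leq_trans (size_sum _ _ _)) //; apply/bigmax_leqP => a _.
rewrite (leq_trans (size_scale_leq _ _)) // size_polyXn ltnS -mulnA.
have -> : (n.+1 * (b * Q ^ n) = \sum_(j < n.+1) b * Q ^ n)%N by rewrite sum_nat_const card_ord.
apply: leq_sum => j _; rewrite leq_mul // ?(ltnW (ltn_ord _)) //.
by rewrite leq_pexp2l // ?(leq_ltn_trans _ (aQ a j)) // -ltnS.
Qed.

Theorem quasi_fixed_point (D : B) : iter n F D != 0 ->
  exists (m : nat) (S : comNzRingType) (h : {rmorphism B -> S}) (T : finType) (e : T -> S),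
  [/\ forall z, exists t, z = e t,
      forall x y : S, x * y = 0 -> x = 0 \/ y = 0,
      forall u, h (F u) = h u ^+ (p ^ m) & h D != 0].
Proof.
move=> FD0.
pose d := (\max_(j < n.+1) \max_i msize (iter j F 'X_i))%N.
pose b := ((n.+1 * d).+1 ^ n).+1.
(* These are [n.+1] polynomials in [n] variables. The relation between them is found before [Q] is
   chosen. *)
have dep i : exists2 c : {ffun {ffun 'I_n.+1 -> 'I_b} -> 'F_p}, c != 0 &
    \sum_a c a *: \prod_(j < n.+1) iter j F 'X_i ^+ a j = 0.
  apply: (@algebraic_dependence _ d) => // j.
  rewrite (@leq_trans d) // (leq_trans _ (leq_bigmax j)) //.
  exact: (@leq_bigmax _ (fun i => msize (iter j F 'X_i))).
have [c cP] := @fin_all_exists _ _ (fun i c => c != 0 /\ _ = 0)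
  (fun i => let: ex_intro2 c c0 cE := dep i in ex_intro _ c (conj c0 cE)).
(* [K * Q^n] will bound the total degree of the relations, with [K] fixed before [Q]. Then [Q > m]
   exceeds [b], the sizes of the [f i] and that of [iter n F D ^+ K]. *)
pose k := (n * (n.+1 * b)).+1; pose K := (p ^ k)%N.
pose m := (b + (\max_i msize (f i)) + K * msize (iter n F D))%N; pose Q := (p ^ m)%N.
have mQ : (m < Q)%N by rewrite ltn_expl // prime_gt1.
have fQ i : (msize (f i) <= Q)%N.
  by have := @leq_bigmax _ (fun i => msize (f i)) i; move: mQ; rewrite /m; lia.
have Q0 : (0 < Q)%N by lia.
have bQ : (b <= Q)%N by move: mQ; rewrite /m; lia.
pose I : set B := fun u => exists c : 'I_n -> B, u = \sum_i c i * power_gap Q f i.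
have Ii : ideal I.
  split=> [|_ _ [c1 ->] [c2 ->]|a _ [c1 ->]].
  - by exists (fun=> 0); rewrite big1 // => i _; rewrite mul0r.
  - exists (fun i => c1 i + c2 i); rewrite -big_split; apply: eq_bigr => i _.
    by rewrite mulrDl.
  - exists (fun i => a * c1 i); rewrite mulr_sumr; apply: eq_bigr => i _.
    by rewrite mulrA.
have I_gap i : I (power_gap Q f i).
  exists (fun j => (i == j)%:R); rewrite (bigD1 i) //= eqxx mul1r big1 ?addr0 // => j.
  by rewrite eq_sym => /negbTE ->; rewrite mul0r.
have I_small u : I u -> (msize u <= Q)%N -> u = 0.
  by move=> [c' uE]; apply: power_gap_comb_small uE.
have ID s : ~ I (D ^+ s).
  move=> IDs.
  have I1 : ~ I 1 by move=> /I_small; rewrite msize1 => /(_ Q0)/eqP; rewrite oner_eq0.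
  have [R [pi [piS piI]]] := ideal_quotient Ii I1.
  pose iota : {rmorphism 'F_p -> R} := pi \o @mpolyC n 'F_p.
  have pR : p \in [pchar R] := Fp_pchar_image iota.
  have piF u : pi (F u) = pi u ^+ Q.
    apply: (@mpoly_rmorph_ext n R (pi \o F) (frobenius pR m \o pi)) => i /=.
    apply/eqP; rewrite frobeniusE eq_sym -subr_eq0 F_X -rmorphXn -rmorphB.
    exact/eqP/piI/I_gap.
  have piFj j u : pi (iter j F u) = pi u ^+ (Q ^ j).
    by elim: j => [|j IHj] //=; rewrite piF IHj -exprM -expnSr.
  pose P i : {poly 'F_p} := \sum_a c i a *: 'X^(\sum_j a j * Q ^ j).
  have PP i := exponent_polynomial (cP i).1 bQ.
  have P_root i : (map_poly iota (P i)).[pi 'X_i] = 0.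
    have := congr1 pi (cP i).2; rewrite rmorph0 rmorph_sum => <-.
    rewrite /P rmorph_sum horner_sum /=; apply: eq_bigr => a _.
    rewrite map_polyZ /= map_polyXn hornerZ hornerXn.
    rewrite -mul_mpolyC rmorphM rmorph_prod; congr (_ * _).
    rewrite expr_sum; apply: eq_bigr => j _.
    by rewrite rmorphXn piFj -exprM mulnC.
  (* The product of the relations supplies one [M] for all variables. *)
  pose PT := \prod_i P i.
  have PT0 : PT != 0 by apply/prodf_neq0 => i _; case: (PP i).
  have [M PM] := dvdp_frobenius_sub p_pr PT0.
  have sPT : ((size PT).-1 <= K * Q ^ n)%N.
    have := @size_prod_leq _ _ predT P; rewrite cardT size_enum_ord => sP.
    have {sP} : (size PT <= (n * (n.+1 * b * Q ^ n).+1).+1 - n)%N.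
      rewrite (leq_trans sP) // leq_sub2r // ltnS.
      have -> : (n * (n.+1 * b * Q ^ n).+1 = \sum_(i < n) (n.+1 * b * Q ^ n).+1)%N.
        by rewrite sum_nat_const card_ord.
      by apply: leq_sum => i _; case: (PP i).
    have kK : (k <= K)%N by rewrite ltnW // ltn_expl // prime_gt1.
    have : (k * Q ^ n <= K * Q ^ n)%N by rewrite leq_mul2r kK orbT.
    rewrite mulnS subSn ?leq_addr // addKn /k; move: (Q ^ n)%N (K * _)%N => x y.
    by rewrite mulSn -!mulnA; lia.
  have zK i : (pi 'X_i ^+ (p ^ M.+1) - pi 'X_i) ^+ (K * Q ^ n) = 0.
    have : P i %| ('X^(p ^ M.+1) - 'X) ^+ (K * Q ^ n).
      apply: dvdp_trans (dvdp_trans PM (dvdp_exp2l _ sPT)).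
      by rewrite /PT (bigD1 i) //= dvdp_mulr.
    case/dvdpP => q /(congr1 (fun r => (map_poly iota r).[pi 'X_i])).
    rewrite rmorphM hornerM P_root mulr0 rmorphXn rmorphB /= map_polyXn map_polyX.
    by rewrite horner_exp !hornerE.
  pose N := (k + m * n)%N.
  have NE : (p ^ N = K * Q ^ n)%N by rewrite /N expnD expnM.
  (* Both sides are ring morphisms in [u], so [zK] on the variables suffices. Thus the [p^(M+1)]-th
     power map fixes every [p^N]-th power, and a nilpotent [p^N]-th power is zero. *)
  have GX u : (pi u ^+ (p ^ N)) ^+ (p ^ M.+1) = pi u ^+ (p ^ N).
    apply: (@mpoly_rmorph_ext n R
      (frobenius pR M.+1 \o (frobenius pR N \o pi)) (frobenius pR N \o pi)) => i /=.
    rewrite !frobeniusE; apply/eqP; rewrite -subr_eq0 -!exprM mulnC exprM -frobeniusB //.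
    by rewrite NE zK.
  have GXl u l : (pi u ^+ (p ^ N)) ^+ (p ^ (M.+1 * l)) = pi u ^+ (p ^ N).
    elim: l => [|l IHl]; first by rewrite muln0.
    by rewrite mulnS expnD exprM GX IHl.
  have : pi D ^+ (p ^ N) = 0.
    rewrite -(GXl D s) -exprM.
    have sp : (s <= p ^ N * p ^ (M.+1 * s))%N.
      rewrite -expnD ltnW // (leq_ltn_trans _ (ltn_expl _ (prime_gt1 p_pr))) //.
      by rewrite mulSn; lia.
    rewrite -(subnK sp) exprD -[pi D ^+ s]rmorphXn.
    by have /piI -> := IDs; rewrite mulr0.
  (* Since [p^N = K * Q^n] and the [Q^n]-th power is [F^n] modulo [I], the power [iter n F D ^+ K]
     lies in [I]; its degree is too small for a nonzero element. *)
  rewrite NE mulnC exprM -piFj -rmorphXn => /piI/I_small FDK.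
  have : iter n F D ^+ K = 0.
    apply: FDK; apply: leq_trans (ltnW mQ).
    rewrite (leq_trans (msize_exp_le _ _)) // /m.
    have : (0 < msize (iter n F D))%N by rewrite lt0n msize_poly_eq0.
    move: (msize (iter n F D)) => x x0; rewrite [(x.-1 * K)%N]mulnC (leq_trans _ (leq_addl _ _)) //.
    by rewrite ltn_pmul2l ?prednK // expn_gt0 prime_gt0.
  by move/eqP; rewrite expf_eq0 (negbTE FD0) andbF.
have [S [h [hS hI hD hdom]]] := domain_quotient_avoiding Ii ID.
have pS : p \in [pchar S] := Fp_pchar_image (h \o @mpolyC n 'F_p).
exists m, S, h, {ffun {ffun 'I_n -> 'I_Q} -> 'F_p},
  (fun c : {ffun {ffun 'I_n -> 'I_Q} -> 'F_p} =>
    \sum_a h (c a)%:MP * \prod_i h 'X_i ^+ a i); split=> //.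
  move=> z; have [u ->] := hS z.
  by apply: (finite_of_power_gap Q0 fQ (h := h)) => i; apply/hI/I_gap.
move=> u; apply: (@mpoly_rmorph_ext n S (h \o F) (frobenius pS m \o h)) => i /=.
apply/eqP; rewrite frobeniusE eq_sym -subr_eq0 F_X -rmorphXn -rmorphB.
exact/eqP/hI/I_gap.
Qed.
End QuasiFixedPoints.

(** * Words in two-by-two matrices *)

Section TwoByTwo.
Import GRing.Theory.
Local Open Scope ring_scope.
Variable C : comNzRingType.
Implicit Types M N : 'M[C]_2.

Definition det2 M : C := M 0 0 * M 1 1 - M 0 1 * M 1 0.

Definition adj2 M : 'M[C]_2 :=
  \matrix_(i, j) if i == j then M (rev_ord i) (rev_ord j) else - M i j.

Definition scalar2 M : Prop := [/\ M 0 1 = 0, M 1 0 = 0 & M 0 0 = M 1 1].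

Lemma ord2P (i : 'I_2) : i = 0 \/ i = 1.
Proof. by case: i => -[|[|//]] lt; [left|right]; apply/val_inj. Qed.

Lemma mx2P n (A B : 'M[C]_(2, n)) :
  (forall j, A 0 j = B 0 j) -> (forall j, A 1 j = B 1 j) -> A = B.
Proof. by move=> H0 H1; apply/matrixP => i j; case: (ord2P i) => ->. Qed.

Lemma mulmx2E m n (A : 'M[C]_(m, 2)) (B : 'M[C]_(2, n)) i j :
  (A *m B) i j = A i 0 * B 0 j + A i 1 * B 1 j.
Proof.
rewrite mxE !big_ord_recl big_ord0 addr0.
by congr (A i _ * B _ j + A i _ * B _ j); apply/val_inj.
Qed.

Lemma adj2E M : [/\ adj2 M 0 0 = M 1 1, adj2 M 0 1 = - M 0 1,
  adj2 M 1 0 = - M 1 0 & adj2 M 1 1 = M 0 0].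
Proof.
by split; rewrite mxE //=; congr (M _ _); apply/val_inj.
Qed.

Lemma scalar_mx2E (c : C) : [/\ (c%:M : 'M[C]_2) 0 0 = c, (c%:M : 'M[C]_2) 0 1 = 0,
  (c%:M : 'M[C]_2) 1 0 = 0 & (c%:M : 'M[C]_2) 1 1 = c].
Proof. by split; rewrite mxE. Qed.

Lemma adj2M M N : adj2 (M *m N) = adj2 N *m adj2 M.
Proof.
have [n0 n1 n2 n3] := adj2E N; have [m0 m1 m2 m3] := adj2E M.
have [c0 c1 c2 c3] := adj2E (M *m N).
apply: mx2P => j; case: (ord2P j) => ->;
  rewrite mulmx2E ?(n0, n1, n2, n3, m0, m1, m2, m3, c0, c1, c2, c3) !mulmx2E; ring.
Qed.

Lemma adj2K : involutive adj2.
Proof.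
move=> M; have [m0 m1 m2 m3] := adj2E M; have [c0 c1 c2 c3] := adj2E (adj2 M).
by apply: mx2P => j; case: (ord2P j) => ->;
  rewrite ?(c0, c1, c2, c3) ?(m0, m1, m2, m3) ?opprK.
Qed.

Lemma adj2_1 : adj2 1%:M = 1%:M.
Proof.
have [c0 c1 c2 c3] := adj2E 1%:M; have [d0 d1 d2 d3] := scalar_mx2E 1.
by apply: mx2P => j; case: (ord2P j) => ->;
  rewrite ?(c0, c1, c2, c3) ?(d0, d1, d2, d3) ?oppr0.
Qed.

Lemma det2M M N : det2 (M *m N) = det2 M * det2 N.
Proof. rewrite /det2 !mulmx2E; ring. Qed.

Lemma det2_adj M : det2 (adj2 M) = det2 M.
Proof. have [m0 m1 m2 m3] := adj2E M; rewrite /det2 m0 m1 m2 m3; ring. Qed.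

Lemma det2_1 : det2 1%:M = 1.
Proof. have [d0 d1 d2 d3] := scalar_mx2E 1; rewrite /det2 d0 d1 d2 d3; ring. Qed.

Lemma mul_adj2 M : adj2 M *m M = (det2 M)%:M.
Proof.
have [m0 m1 m2 m3] := adj2E M; have [d0 d1 d2 d3] := scalar_mx2E (det2 M).
by apply: mx2P => j; case: (ord2P j) => ->;
  rewrite mulmx2E ?(m0, m1, m2, m3, d0, d1, d2, d3) /det2; ring.
Qed.

Lemma mul2_adj M : M *m adj2 M = (det2 M)%:M.
Proof. by have := mul_adj2 (adj2 M); rewrite adj2K det2_adj. Qed.

Lemma scalar2_comm M : (forall N, M *m N = N *m M) -> scalar2 M.
Proof.
move=> comm; pose e i j : 'M[C]_2 := delta_mx i j.
have e01 := comm (e 0 1); have e10 := comm (e 1 0).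
have E i j a b : e i j a b = ((a == i) && (b == j))%:R by rewrite mxE.
split.
- have := congr1 (fun N : 'M[C]_2 => N 0 0) e10.
  by rewrite !mulmx2E !E /= !(mulr0, mul0r, mulr1, mul1r, addr0, add0r).
- have := congr1 (fun N : 'M[C]_2 => N 0 0) e01.
  by rewrite !mulmx2E !E /= !(mulr0, mul0r, mulr1, mul1r, addr0, add0r).
- have := congr1 (fun N : 'M[C]_2 => N 0 1) e01.
  by rewrite !mulmx2E !E /= !(mulr0, mul0r, mulr1, mul1r, addr0, add0r).
Qed.

Hypothesis domain : forall x y : C, x * y = 0 -> x = 0 \/ y = 0.

Lemma mulmx2_lcancel M N N' : det2 M != 0 -> M *m N = M *m N' -> N = N'.
Proof.
move=> M0 /(congr1 (mulmx (adj2 M))); rewrite !mulmxA mul_adj2 !mul_scalar_mx => E.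
apply/matrixP => i j; have := congr1 (fun K : 'M[C]_2 => K i j) E.
rewrite !mxE => /eqP; rewrite -subr_eq0 -mulrBr => /eqP /domain [/eqP|/eqP].
  by rewrite (negbTE M0).
by rewrite subr_eq0 => /eqP.
Qed.

Lemma mulmx2_rcancel M N N' : det2 M != 0 -> N *m M = N' *m M -> N = N'.
Proof.
move=> M0 /(congr1 adj2); rewrite !adj2M => /mulmx2_lcancel.
by rewrite det2_adj => /(_ M0) /(inv_inj adj2K).
Qed.

End TwoByTwo.

(** * Evaluation of words at tuples of matrices *)

Section WordEvaluation.
Import GRing.Theory.
Local Open Scope ring_scope.
Variable k : nat.
Local Notation word := (word 'I_k).

Definition letter_mx (C : comNzRingType) (A : 'I_k -> 'M[C]_2) (l : 'I_k * bool) : 'M[C]_2 :=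
  if l.2 then A l.1 else adj2 (A l.1).

(* An inverse letter is evaluated as an adjugate, so that the entries of the
   value are polynomials in the entries of the matrices. *)
Definition word_mx (C : comNzRingType) (A : 'I_k -> 'M[C]_2) (w : word) : 'M[C]_2 :=
  foldr (fun l M => letter_mx A l *m M) 1%:M w.

Definition word_subst (W : 'I_k -> word) (w : word) : word :=
  flatten [seq if l.2 then W l.1 else word_inv (W l.1) | l <- w].

Section Evaluation.
Variables (C : comNzRingType) (A : 'I_k -> 'M[C]_2).

Lemma word_mx_cat u v : word_mx A (u ++ v) = word_mx A u *m word_mx A v.
Proof. by elim: u => [|l u IHu] /=; rewrite ?mul1mx // IHu mulmxA. Qed.

Lemma word_mx_inv u : word_mx A (word_inv u) = adj2 (word_mx A u).
Proof.
elim: u => [|[x b] u IHu]; first by rewrite /= adj2_1.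
rewrite /word_inv map_cons rev_cons -cats1 word_mx_cat -/(word_inv u) IHu.
rewrite /= mulmx1 adj2M; congr (_ *m _).
by case: b; rewrite /letter_mx //= adj2K.
Qed.

Lemma word_mx_subst (W : 'I_k -> word) w :
  word_mx A (word_subst W w) = word_mx (fun i => word_mx A (W i)) w.
Proof.
elim: w => [|[x b] w IHw] //.
rewrite /word_subst /= word_mx_cat IHw; congr (_ *m _).
by case: b; rewrite /letter_mx //= word_mx_inv.
Qed.

Lemma det2_word_mx1 w : (forall i, det2 (A i) = 1) -> det2 (word_mx A w) = 1.
Proof.
move=> A1; elim: w => [|[x b] w IHw] /=; first exact: det2_1.
by rewrite det2M IHw /letter_mx /=; case: b; rewrite ?det2_adj A1 mulr1.
Qed.

Lemma word_mx_eq u v : (forall i, det2 (A i) = 1) -> word_eq u v ->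
  word_mx A u = word_mx A v.
Proof.
move=> A1; elim=> [//|u' v' _ ->//|u' v' w' _ -> _ ->//|u' v' x b].
rewrite !word_mx_cat; congr (_ *m _).
rewrite -[LHS]/(letter_mx A (x, b) *m (letter_mx A (x, ~~ b) *m word_mx A v')) mulmxA.
suff -> : letter_mx A (x, b) *m letter_mx A (x, ~~ b) = 1%:M by rewrite mul1mx.
by case: b; rewrite /letter_mx /= ?mul_adj2 ?mul2_adj A1.
Qed.

End Evaluation.

Lemma map_word_mx (C C' : comNzRingType) (h : {rmorphism C -> C'}) (A : 'I_k -> 'M[C]_2) w :
  map_mx h (word_mx A w) = word_mx (fun i => map_mx h (A i)) w.
Proof.
elim: w => [|[x b] w IHw] /=; first by rewrite map_scalar_mx rmorph1.
rewrite map_mxM IHw; congr (_ *m _); rewrite /letter_mx; case: b => //=.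
by apply/matrixP => i j; rewrite !mxE; case: eqP => _; rewrite ?rmorphN.
Qed.

Lemma map_det2 (C C' : comNzRingType) (h : {rmorphism C -> C'}) (M : 'M[C]_2) :
  det2 (map_mx h M) = h (det2 M).
Proof. by rewrite /det2 !mxE rmorphB !rmorphM. Qed.

Definition cancels (l l' : 'I_k * bool) := (l.1 == l'.1) && (l.2 != l'.2).

Definition reduced (w : word) := sorted (fun l l' => ~~ cancels l l') w.

Lemma exists_reduced w : exists2 w', reduced w' & word_eq w w'.
Proof.
elim: w => [|l w [w' w'r ww']]; first by exists [::] => //; exact: word_eq_refl.
have lw : word_eq (l :: w) (l :: w').
  by rewrite -cat1s -(cat1s l w'); apply: word_eq_cat => //; apply: word_eq_refl.
case: w' w'r ww' lw => [|l' w'] w'r ww' lw; first by exists [:: l].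
have [/andP[l1 l2]|ncan] := boolP (cancels l l').
  exists w'; first exact: path_sorted w'r.
  apply: word_eq_trans lw _; case: l l' l1 l2 {w'r ww'} => [x b] [x' b'] /= /eqP <- bb'.
  have -> : b' = ~~ b by case: b b' bb' => -[].
  exact: (word_eq_cancel [::]).
by exists (l :: l' :: w') => //=; rewrite ncan.
Qed.

(** * A faithful ping-pong representation over a polynomial ring *)

Section PingPong.
Variable K : idomainType.
Local Notation C := {poly K}.

Definition upper (f : C) : 'M[C]_2 :=
  \matrix_(i, j) if i == j then 1 else if i == 0 then f else 0.
Definition lower (f : C) : 'M[C]_2 := (upper f)^T.

Lemma upper_col f (v : 'cV[C]_2) :
  (upper f *m v) 0 0 = v 0 0 + f * v 1 0 /\ (upper f *m v) 1 0 = v 1 0.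
Proof. by split; rewrite mulmx2E !mxE /= !(mul1r, mul0r, add0r). Qed.

Lemma lower_col f (v : 'cV[C]_2) :
  (lower f *m v) 0 0 = v 0 0 /\ (lower f *m v) 1 0 = f * v 0 0 + v 1 0.
Proof. by split; rewrite mulmx2E !mxE /= !(mul1r, mul0r, addr0). Qed.

Definition top_heavy (v : 'cV[C]_2) := (size (v 1 0)%R < size (v 0 0)%R)%N.
Definition bottom_heavy (v : 'cV[C]_2) := (size (v 0 0)%R < size (v 1 0)%R)%N.

Lemma size_mulD_gt (f a b : C) : (1 < size f)%N -> (size a <= size b)%N -> b != 0 ->
  (size b < size (a + f * b)%R)%N.
Proof.
move=> f2 ab b0; have f0 : f != 0 by rewrite -size_poly_eq0; lia.
have sfb : size (f * b) = (size f + size b).-1 by rewrite size_mul.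
have b1 : (0 < size b)%N by rewrite lt0n size_poly_eq0.
by rewrite addrC size_polyDl sfb; lia.
Qed.

Lemma upper_top (f : C) v : (1 < size f)%N -> bottom_heavy v -> top_heavy (upper f *m v).
Proof.
move=> f2; rewrite /bottom_heavy /top_heavy; have [-> ->] := upper_col f v => vb.
apply: size_mulD_gt => //; first exact: ltnW.
by rewrite -size_poly_eq0; lia.
Qed.

Lemma lower_bottom (f : C) v : (1 < size f)%N -> top_heavy v -> bottom_heavy (lower f *m v).
Proof.
move=> f2; rewrite /bottom_heavy /top_heavy; have [-> ->] := lower_col f v => vb.
rewrite addrC; apply: size_mulD_gt => //; first exact: ltnW.
by rewrite -size_poly_eq0; lia.
Qed.

Lemma upperM f g : upper f *m upper g = upper (f + g).
Proof. by apply: mx2P => j; case: (ord2P j) => ->; rewrite mulmx2E !mxE /=; ring. Qed.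

Lemma lowerM f g : lower f *m lower g = lower (f + g).
Proof. by rewrite /lower -trmx_mul upperM addrC. Qed.

Lemma adj2_upper f : adj2 (upper f) = upper (- f).
Proof. by apply: mx2P => j; case: (ord2P j) => ->; rewrite !mxE /= ?oppr0. Qed.

Lemma adj2_lower f : adj2 (lower f) = lower (- f).
Proof. by apply: mx2P => j; case: (ord2P j) => ->; rewrite !mxE /= ?oppr0. Qed.

(** Distinct positive exponents make every shear, and every difference of two of them,
    nonconstant. *)
Definition shear (i : 'I_k) : C := 'X^(i.+1).
Definition pingpong (i : 'I_k) : 'M[C]_2 := upper (shear i) *m lower (shear i).

Lemma det2_pingpong i : det2 (pingpong i) = 1.
Proof. rewrite det2M /det2 !mxE /=; ring. Qed.

Lemma size_shear i : (1 < size (shear i))%N.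
Proof. by rewrite size_polyXn. Qed.

Lemma size_shearB i j : i != j -> (1 < size (shear i - shear j)%R)%N.
Proof.
move=> ij; rewrite ltnNge; apply/negP => s1.
have : (shear i - shear j)`_i.+1 = 0 by rewrite nth_default // (leq_trans s1).
rewrite coefB !coefXn eqxx eqSS (inj_eq val_inj) (negbTE ij) subr0 => /eqP.
by rewrite oner_eq0.
Qed.

Definition ones : 'cV[C]_2 := const_mx 1.

(* The leftmost shear is kept explicit because it may merge with the next letter. *)
Lemma pingpong_orbit l w : reduced (l :: w) ->
  let v := word_mx pingpong (l :: w) *m ones in
  if l.2 then exists2 v', bottom_heavy v' & v = upper (shear l.1) *m v'
  else exists2 v', top_heavy v' & v = lower (- shear l.1) *m v'.
Proof.
have letE (i : 'I_k) b : letter_mx pingpong (i, b) =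
    if b then upper (shear i) *m lower (shear i)
    else lower (- shear i) *m upper (- shear i).
  by case: b => //; rewrite /letter_mx /= adj2M adj2_upper adj2_lower.
have sN i : (1 < size (- shear i)%R)%N by rewrite size_polyN size_shear.
elim: w l => [|[j c] w IHw] [i b] /=.
  move=> _; rewrite mulmx1 letE; case: b => /=.
    exists (lower (shear i) *m ones); last by rewrite mulmxA.
    rewrite /bottom_heavy; have [-> ->] := lower_col (shear i) ones.
    by rewrite addrC size_mulD_gt ?size_shear // !mxE // oner_eq0.
  exists (upper (- shear i) *m ones); last by rewrite mulmxA.
  rewrite /top_heavy; have [-> ->] := upper_col (- shear i) ones.
  by rewrite size_mulD_gt // !mxE // oner_eq0.
move=> /andP[ij /IHw] /=; rewrite -!mulmxA; move: (_ *m (_ *m ones)) => v.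
rewrite letE; case: b c ij => -[] /= ij [v' hv' ->].
- exists (lower (shear i) *m (upper (shear j) *m v')); last by rewrite !mulmxA.
  by apply: lower_bottom; [exact: size_shear|apply: upper_top; first exact: size_shear].
(* Opposite signs put two lower shears side by side, and they merge; reducedness forces [i != j], so
   the merged shear is still nonconstant. *)
- exists (lower (shear i - shear j) *m v'); last by rewrite -lowerM !mulmxA.
  apply: lower_bottom => //; apply: size_shearB.
  by apply: contraNneq ij => ->; rewrite /cancels eqxx.
- exists (upper (- shear i + shear j) *m v'); last by rewrite -upperM !mulmxA.
  apply: upper_top => //; rewrite addrC; apply: size_shearB.
  by apply: contraNneq ij => ->; rewrite /cancels eqxx.
- exists (upper (- shear i) *m (lower (- shear j) *m v')); last by rewrite !mulmxA.
  by apply: upper_top => //; apply: lower_bottom.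
Qed.

(** A scalar matrix keeps the two entries of [ones] equal, whereas a nonempty reduced word sends
    [ones] to a vector with entries of different sizes. *)
Lemma pingpong_nonscalar w : ~ word_eq w [::] -> ~ scalar2 (word_mx pingpong w).
Proof.
move=> w1 [M01 M10 M00]; have [w' w'r ww'] := exists_reduced w.
rewrite (word_mx_eq det2_pingpong ww') in M01 M10 M00.
case: w' w'r ww' M01 M10 M00 => [//|l w' /pingpong_orbit /= + _].
move: (letter_mx _ _ *m word_mx _ w') => M vP M01 M10 M00.
have : (M *m ones) 0 0 = (M *m ones) 1 0.
  by rewrite !mulmx2E M01 M10 M00 !mxE !(mulr1, mul0r) addr0 add0r.
have sN i : (1 < size (- shear i)%R)%N by rewrite size_polyN size_shear.
case: (l.2) vP => -[v' hv' vE] E; move: E; rewrite vE => E.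
  by have := upper_top (size_shear l.1) hv'; rewrite /top_heavy E ltnn.
by have := lower_bottom (sN l.1) hv'; rewrite /bottom_heavy E ltnn.
Qed.

End PingPong.
End WordEvaluation.

(** * Matrix tuples that a substitution maps to their Frobenius image *)

Section MatrixPoint.
Import GRing.Theory mpoly.
Local Open Scope ring_scope.
Variables (p k : nat) (W : 'I_k -> word 'I_k).
Hypothesis p_pr : prime p.
Local Notation V := ('I_k * ('I_2 * 'I_2))%type.
Local Notation n := #|{: V}|.
Local Notation B := {mpoly 'F_p[n]}.

Let X (i : 'I_k) : 'M[B]_2 := \matrix_(a, b) 'X_(enum_rank (i, (a, b)) : 'I_n).
Let f (j : 'I_n) : B := let: (i, (a, b)) := enum_val j in word_mx X (W i) a b.
Let F : {rmorphism B -> B} := mmap (@mpolyC n 'F_p) f.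

Let map_F_X i : map_mx F (X i) = word_mx X (W i).
Proof. by apply/matrixP => a b; rewrite !mxE /F /= mmapX mmap1U /f enum_rankK. Qed.

Let word_step (C : comNzRingType) (A : 'I_k -> 'M[C]_2) i := word_mx A (W i).

Let map_iter_F (C : comNzRingType) (h : {rmorphism B -> C}) j :
  exists h' : {rmorphism B -> C}, (forall u, h' u = h (iter j F u)) /\
    forall i, map_mx h' (X i) = iter j (@word_step C) (fun i => map_mx h (X i)) i.
Proof.
elim: j => [|j [h' [h'E h'X]]]; first by exists h.
exists (h' \o F); split=> [u|i]; first by rewrite /= h'E -iterSr.
rewrite map_mx_comp map_F_X map_word_mx /= /word_step; congr word_mx.
by apply/funext => i'; rewrite h'X.
Qed.

Let word_mx_iter (C : comNzRingType) (A : 'I_k -> 'M[C]_2) j w :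
  word_mx (iter j (@word_step C) A) w = word_mx A (iter j (word_subst W) w).
Proof.
elim: j w => [//|j IHj] w.
by rewrite [in RHS]iterSr -IHj word_mx_subst.
Qed.

(** [quasi_fixed_point] is applied to [D], the product of the determinants of the generic matrices
    and a polynomial that detects nonscalar values of [u]. To see that [D] survives [n] applications
    of [F], evaluate at the ping-pong matrices: the determinants become 1, and the last factor is
    read off from the [n]-th iterate of [u]. *)
Theorem matrix_point (u : word 'I_k) :
  (forall j, ~ word_eq (iter j (word_subst W) u) [::]) ->
  exists (m : nat) (S : comNzRingType) (T : finType) (e : T -> S) (A : 'I_k -> 'M[S]_2),
  [/\ p \in [pchar S], forall z, exists t, z = e t &
      forall x y : S, x * y = 0 -> x = 0 \/ y = 0] /\
  [/\ forall i, map_mx (fun x => x ^+ (p ^ m)) (A i) = word_mx A (W i),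
      forall i, det2 (A i) != 0 & ~ scalar2 (word_mx A u)].
Proof.
move=> u1; pose N := word_mx (@pingpong k 'F_p) (iter n (word_subst W) u).
have nsN : ~ scalar2 N by apply: pingpong_nonscalar.
(* The values of [gap] all vanish exactly for scalar matrices; the index [s] is chosen below so that
   the value at [N] is nonzero. *)
pose gap := fun (C : comNzRingType) s (M : 'M[C]_2) =>
  match s with 0%N => M 0 1 | 1%N => M 1 0 | _ => M 0 0 - M 1 1 end.
have gap_map (C C' : comNzRingType) (h : {rmorphism C -> C'}) s (M : 'M[C]_2) :
    gap C' s (map_mx h M) = h (gap C s M).
  by case: s => [|[|s]]; rewrite /gap ?mxE // rmorphB.
have gap_scalar (C : comNzRingType) s (M : 'M[C]_2) : scalar2 M -> gap C s M = 0.
  by case=> M0 M1 M2; case: s => [|[|s]] //=; rewrite M2 subrr.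
have [s sN] : exists s, gap _ s N != 0.
  apply: contrapT => /forallNP H.
  have {}H s : gap _ s N = 0 by apply/eqP; have /negP := H s; rewrite negbK.
  by apply: nsN; split; [exact: (H 0%N)|exact: (H 1%N)|apply/eqP; rewrite -subr_eq0 -(H 2)].
pose D := (\prod_i det2 (X i)) * gap _ s (word_mx X u).
have FD : iter n F D != 0.
  pose ev : {rmorphism B -> {poly 'F_p}} :=
    mmap (@polyC 'F_p) (fun j : 'I_n => let: (i, (a, b)) := enum_val j in @pingpong k 'F_p i a b).
  have evX : (fun i => map_mx ev (X i)) = @pingpong k 'F_p.
    apply/funext => i; apply/matrixP => a b.
    by rewrite mxE mxE /ev /= mmapX mmap1U enum_rankK.
  have [h [hE hX]] := map_iter_F ev n; rewrite evX in hX.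
  have det1 j i : det2 (iter j (@word_step _) (@pingpong k 'F_p) i) = 1.
    by elim: j i => [|j IHj] i; [exact: det2_pingpong|apply: det2_word_mx1].
  apply: contraNneq sN => FD0; have := hE D; rewrite FD0 rmorph0 /D rmorphM.
  rewrite rmorph_prod big1 ?mul1r => [|i _]; last by rewrite -map_det2 hX det1.
  rewrite -gap_map map_word_mx.
  have -> : (fun i => map_mx h (X i)) = iter n (@word_step _) (@pingpong k 'F_p).
    by apply/funext.
  by rewrite word_mx_iter => ->.
have [m [S [h [T [e [eS dom hF hD]]]]]] := quasi_fixed_point p_pr FD.
exists m, S, T, e, (fun i => map_mx h (X i)); split; split=> //.
- exact: (Fp_pchar_image p_pr (h \o @mpolyC n 'F_p)).
- move=> i; rewrite -map_word_mx -map_F_X.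
  by apply/matrixP => a b; rewrite !mxE hF.
- move=> i; rewrite map_det2; apply: contraNneq hD => hdet.
  by rewrite /D (bigD1 i) //= !rmorphM hdet !mul0r.
- move=> sc; case/negP: hD; rewrite /D rmorphM -gap_map map_word_mx.
  by rewrite gap_scalar // mulr0.
Qed.
End MatrixPoint.

(** * Free groups and HNN extensions *)

Section GroupMorphisms.
Local Open Scope group_scope.
Variables (G H : groupType) (f : {multiplicative G -> H}).

Lemma multiplicative1 : f 1 = 1.
Proof. by apply: (@mulgI _ (f 1)); rewrite -gmulfM !mulg1. Qed.

Lemma multiplicativeV x : f x^-1 = (f x)^-1.
Proof. by apply: (@mulgI _ (f x)); rewrite -gmulfM !mulgV multiplicative1. Qed.

Lemma ker_normal1 : [set x | f x = 1]%classic 1.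
Proof. exact: multiplicative1. Qed.

Lemma ker_normalM x y : f x = 1 -> f y = 1 -> f (x * y) = 1.
Proof. by rewrite gmulfM => -> ->; rewrite mulg1. Qed.

Lemma ker_normalV x : f x = 1 -> f x^-1 = 1.
Proof. by rewrite multiplicativeV => ->; rewrite invg1. Qed.

Lemma ker_normalJ x g : f x = 1 -> f (x ^ g) = 1.
Proof. by rewrite /conjg !gmulfM multiplicativeV => ->; rewrite mul1g mulVg. Qed.

Definition ker_normal : normal_subgroup G :=
  @NormalSubgroup G [set x | f x = 1]%classic ker_normal1 ker_normalM ker_normalV ker_normalJ.

End GroupMorphisms.

(** * The universal property of free groups *)

Section FreeLift.
Local Open Scope group_scope.
Local Open Scope quotient_scope.
Variables (X : choiceType) (K : groupType) (x : X -> K).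

Definition word_val (w : word X) : K :=
  foldr (fun l y => (if l.2 then x l.1 else (x l.1)^-1) * y) 1 w.

Lemma word_val_cat u v : word_val (u ++ v) = word_val u * word_val v.
Proof. by elim: u => [|l u IHu] /=; rewrite ?mul1g // IHu mulgA. Qed.

Lemma word_val_eq u v : word_eq u v -> word_val u = word_val v.
Proof.
elim=> [//|u' v' _ ->//|u' v' w _ -> _ ->//|u' v' a b].
by rewrite !word_val_cat; case: b => /=; rewrite ?mulKg ?mulVKg.
Qed.

Definition free_lift (g : free_group X) : K := word_val (repr g).

Lemma free_lift_pi w : free_lift (\pi_(free_group X) w) = word_val w.
Proof. exact/word_val_eq/repr_word. Qed.

Lemma free_liftM : {morph free_lift : g h / g * h}.
Proof. by move=> g h; rewrite /free_lift -word_val_cat; apply/word_val_eq/repr_word. Qed.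

HB.instance Definition _ := isMultiplicative.Build _ _ free_lift free_liftM.

Lemma free_lift_gen a : free_lift (free_gen a) = x a.
Proof. by rewrite free_lift_pi /= mulg1. Qed.

End FreeLift.

Section FreeExtensionality.
Local Open Scope group_scope.
Local Open Scope quotient_scope.
Variables (X : choiceType).

Lemma pi_free_cat (u v : word X) :
  \pi_(free_group X) (u ++ v) = \pi_(free_group X) u * \pi_(free_group X) v.
Proof. by apply/word_eqE/word_eq_sym/word_eq_cat; apply: repr_word. Qed.

Lemma pi_free_letter (a : X) b :
  \pi_(free_group X) [:: (a, b)] = if b then free_gen a else (free_gen a)^-1.
Proof.
case: b => //; apply: (@mulgI _ (free_gen a)); rewrite mulgV -pi_free_cat.
exact/word_eqE/(word_eq_cancel [::] [::] a true).
Qed.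

Lemma free_ind (P : free_group X -> Prop) : P 1 ->
  (forall a g, P g -> P (free_gen a * g) /\ P ((free_gen a)^-1 * g)) -> forall g, P g.
Proof.
move=> P1 PM g; rewrite -[g]reprK; elim: (repr g) => [//|[a b] w IHw].
rewrite -cat1s pi_free_cat pi_free_letter.
by have [] := PM a _ IHw; case: b.
Qed.

Lemma free_ext (K : groupType) (f h : {multiplicative free_group X -> K}) :
  (forall a, f (free_gen a) = h (free_gen a)) -> f =1 h.
Proof.
move=> fh; apply: free_ind => [|a g IHg]; first by rewrite !multiplicative1.
by rewrite !gmulfM !multiplicativeV IHg fh.
Qed.

End FreeExtensionality.

(** * Universal property and normal form of ascending HNN extensions *)

Section HNNTheory.
Local Open Scope group_scope.
Local Open Scope quotient_scope.
Variables (G : groupType) (phi : {multiplicative G -> G}).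
Local Notation Gam := (ascending_hnn phi).
Local Notation closure := (normal_closure (hnn_relators phi)).

Definition hnn_base (g : G) : Gam := coset_map closure (free_gen (Some g)).
Definition hnn_stable : Gam := coset_map closure (free_gen None).

Lemma coset_map_relator r : hnn_relators phi r -> coset_map closure r = 1.
Proof.
move=> rR; rewrite -(multiplicative1 (coset_map closure)).
by apply/cosetE; rewrite mulg1; apply: normalV => N; apply.
Qed.

Lemma hnn_baseM : {morph hnn_base : g h / g * h}.
Proof.
move=> g h; apply/esym; rewrite /hnn_base -gmulfM; apply: divg1_eq.
rewrite -multiplicativeV -gmulfM; apply: coset_map_relator; left.
by exists g, h.
Qed.

HB.instance Definition _ := isMultiplicative.Build _ _ hnn_base hnn_baseM.

Lemma hnn_relation g : hnn_stable^-1 * hnn_base g * hnn_stable = hnn_base (phi g).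
Proof.
rewrite /hnn_stable /hnn_base -multiplicativeV -!gmulfM; apply: divg1_eq.
rewrite -multiplicativeV -gmulfM; apply: coset_map_relator; right.
by exists g.
Qed.

(** The map induced on the free group kills the relators, so its kernel contains their normal
    closure. *)
Lemma hnn_lift (K : groupType) (rho : {multiplicative G -> K}) (tau : K) :
  (forall g, tau^-1 * rho g * tau = rho (phi g)) ->
  exists h : {multiplicative Gam -> K}, (forall g, h (hnn_base g) = rho g) /\ h hnn_stable = tau.
Proof.
move=> rel; pose x (a : option G) := if a is Some g then rho g else tau.
have kill u : normal_set closure u -> free_lift x u = 1.
  move=> /(_ (ker_normal (free_lift x))); apply => r [[g [h ->]]|[g ->]] /=;
    rewrite !gmulfM !multiplicativeV /= !free_lift_gen /= ?gmulfM ?mulgV //.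
  by rewrite -rel mulgV.
pose h (a : Gam) := free_lift x (repr a).
have hE u : h (coset_map closure u) = free_lift x u.
  have : normal_set closure ((repr (coset_map closure u))^-1 * u) by apply/cosetE; rewrite reprK.
  by move/kill; rewrite gmulfM multiplicativeV => /(congr1 (fun y => h (coset_map closure u) * y));
    rewrite mulVKg mulg1.
have hM : {morph h : a b / a * b}.
  by move=> a b; rewrite -[a]reprK -[b]reprK -!/(coset_map closure _) -gmulfM !hE gmulfM.
pose hm : {multiplicative Gam -> K} := HB.pack h (isMultiplicative.Build _ _ h hM).
by exists hm; split=> [g|]; rewrite [LHS]hE free_lift_gen.
Qed.

Lemma hnn_ind (P : Gam -> Prop) : P 1 ->
  (forall g x, P x -> P (hnn_base g * x)) ->
  (forall x, P x -> P (hnn_stable * x)) -> (forall x, P x -> P (hnn_stable^-1 * x)) ->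
  forall x, P x.
Proof.
move=> P1 PG Pt PtV x; rewrite -[x]reprK -/(coset_map closure _).
elim/free_ind: (repr x) => [|[g|] u IHu]; first by rewrite multiplicative1.
  rewrite !gmulfM multiplicativeV -/(hnn_base g); split; first exact: PG.
  by have := PG g^-1 _ IHu; rewrite multiplicativeV.
by rewrite !gmulfM multiplicativeV; split; [apply: Pt|apply: PtV].
Qed.

Lemma hnn_ext (K : groupType) (f h : {multiplicative Gam -> K}) :
  (forall g, f (hnn_base g) = h (hnn_base g)) -> f hnn_stable = h hnn_stable -> f =1 h.
Proof.
move=> fb ft; apply: hnn_ind => [|g x IHx|x IHx|x IHx]; first by rewrite !multiplicative1.
- by rewrite !gmulfM fb IHx.
- by rewrite !gmulfM ft IHx.
- by rewrite !gmulfM !multiplicativeV ft IHx.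
Qed.

(** The relation, in the forms [g t = t phi(g)] and [t^-1 g = phi(g) t^-1], moves positive powers of
    the stable letter to the left and negative ones to the right. *)
Lemma hnn_normal_form (x : Gam) :
  exists a b g, x = hnn_stable ^+ a * hnn_base g * hnn_stable ^- b.
Proof.
have push a g : hnn_base g * hnn_stable ^+ a = hnn_stable ^+ a * hnn_base (iter a phi g).
  elim: a g => [|a IHa] g; first by rewrite expg0 mulg1 mul1g.
  by rewrite expgSr mulgA IHa iterS -hnn_relation !mulgA mulgK.
elim/hnn_ind: x => [|g x [a [b [h ->]]]|x [a [b [h ->]]]|x [[|a] [b [h ->]]]].
- by exists 0, 0, 1; rewrite multiplicative1 !expg0 invg1 !mulg1.
- by exists a, b, (iter a phi g * h); rewrite !mulgA push gmulfM !mulgA.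
- by exists a.+1, b, h; rewrite expgS !mulgA.
- exists 0, b.+1, (phi h); rewrite !expg0 !mul1g -hnn_relation expgSr invgM.
  by rewrite !mulgA mulgK.
- by exists a, b, h; rewrite expgS !mulgA mulVg mul1g.
Qed.

End HNNTheory.

(** * Residual finiteness *)

Section FiniteIndex.
Local Open Scope group_scope.
Local Open Scope classical_set_scope.

Lemma finite_inj (T U : Type) (f : T -> U) : injective f ->
  finite_set [set: U] -> finite_set [set: T].
Proof.
by move=> fI; rewrite -(preimage_setT f); apply: finite_preimage => x y _ _ /fI.
Qed.

Lemma finite_index_fiber (G : groupType) (N : normal_subgroup G) (T : Type) (f : G -> T) :
  finite_set [set: T] -> (forall x y, f x = f y -> normal_set N (x^-1 * y)) -> finite_index N.
Proof.
move=> finT fN; apply: (@finite_inj (quotient_group N) T (fun a => f (repr a))) => //.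
by move=> a b /fN /cosetE; rewrite !reprK.
Qed.

Lemma finite_index_ker (G H : groupType) (f : {multiplicative G -> H}) :
  finite_set [set: H] -> finite_index (ker_normal f).
Proof.
move=> finH; apply: (finite_index_fiber (f := f) finH) => x y xy.
by rewrite /= gmulfM multiplicativeV xy mulVg.
Qed.

End FiniteIndex.

Section Exponent.
Local Open Scope group_scope.
Variables (G : groupType) (phi : {multiplicative G -> G}).

(** This is the exponent sum of the stable letter modulo [m.+1]; the group law on ['I_m.+1] is
    addition. *)
Lemma hnn_exponent m : exists h : {multiplicative ascending_hnn phi -> 'I_m.+1},
  (forall g, h (hnn_base phi g) = 1) /\ h (hnn_stable phi) = Zp1.
Proof.
have oneM : {morph (fun _ : G => 1 : 'I_m.+1) : x y / x * y} by move=> x y; rewrite mulg1.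
pose one : {multiplicative G -> 'I_m.+1} :=
  HB.pack (fun _ : G => 1 : 'I_m.+1) (isMultiplicative.Build _ _ _ oneM).
by apply: (hnn_lift (rho := one)) => g; rewrite mulg1 mulVg.
Qed.

Lemma hnn_exponent_eq m (h : {multiplicative ascending_hnn phi -> 'I_m.+1}) a b g :
  (forall g, h (hnn_base phi g) = 1) -> h (hnn_stable phi) = Zp1 ->
  h (hnn_stable phi ^+ a * hnn_base phi g * hnn_stable phi ^- b) = 1 ->
  a = b %[mod m.+1].
Proof.
move=> hb ht; rewrite !gmulfM hb mulg1 multiplicativeV.
have expE c : h (hnn_stable phi ^+ c) = Zp1 ^+ c.
  elim: c => [|c IHc]; first by rewrite !expg0 multiplicative1.
  by rewrite !expgS gmulfM ht IHc.
rewrite !expE => /divg1_eq; rewrite !Zp_expg => /(congr1 val) /=.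
by rewrite !modnMml !mul1n.
Qed.

End Exponent.

Section ResidualFiniteness.
Import GRing.Theory.
Local Open Scope ring_scope.
Local Open Scope group_scope.
Local Open Scope quotient_scope.

(** * Permutations of the matrices over a finite domain *)

Section ConjugationAction.
Variables (k : nat) (S : comNzRingType) (T : finType) (e : T -> S).
Hypothesis eS : forall z, exists t, z = e t.
Hypothesis domain : forall x y : S, (x * y = 0 -> x = 0 \/ y = 0)%R.
Variable A : 'I_k -> 'M[S]_2.
Hypothesis A_det : forall i, det2 (A i) != 0%R.

Let mx_enum := undup [seq map_mx e M | M : 'M[T]_2].

Let mx_enumP : Finite.axiom mx_enum.
Proof.
apply: Finite.uniq_enumP; first exact: undup_uniq.
move=> M; rewrite mem_undup; apply/fintype.imageP.
have [s sP] := choice eS.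
by exists (map_mx s M) => //; apply/matrixP => i j; rewrite !mxE -sP.
Qed.

Let index_enumK : cancel (index^~ mx_enum) (nth 0%R mx_enum).
Proof.
move=> M; apply: nth_index; have := mx_enumP M.
by rewrite -has_pred1 has_count => ->.
Qed.

Let MT : finType := HB.pack 'M[S]_2 (CanIsCountable index_enumK)
  (isFinite.Build 'M[S]_2 mx_enumP).

Let mull_inj i : injective (fun M : MT => A i *m M : MT).
Proof. by move=> M N; apply: mulmx2_lcancel. Qed.

Let mulr_inj i : injective (fun M : MT => (M : 'M[S]_2) *m A i : MT).
Proof. by move=> M N; apply: mulmx2_rcancel. Qed.

(** The map [M |-> A_i^-1 M A_i], obtained without inverting the matrix: both multiplications by
    [A i] are injective on a finite set. *)
Let conj_mx i : {perm MT} := perm (@mulr_inj i) * (perm (@mull_inj i))^-1.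

Let conj_mxE i (M : MT) : A i *m conj_mx i M = (M : 'M[S]_2) *m A i.
Proof.
have := permKV (perm (@mull_inj i)) (perm (@mulr_inj i) M).
by rewrite /conj_mx permM [in LHS]permE [RHS]permE.
Qed.

(** Inverse letters are evaluated as adjugates, which conjugate like inverses because the two differ
    by the determinant, a nonzero scalar. *)
Let conj_word w (M : MT) :
  word_mx A w *m word_val conj_mx w M = (M : 'M[S]_2) *m word_mx A w.
Proof.
elim: w M => [|[x b] w IHw] M /=; first by rewrite perm1 mulmx1 mul1mx.
rewrite permM -mulmxA IHw !mulmxA; congr (_ *m _).
case: b; rewrite /letter_mx /=; first exact: conj_mxE.
have := conj_mxE x ((conj_mx x)^-1 M); rewrite permKV.
move: ((conj_mx x)^-1 M) => N E; apply: (mulmx2_lcancel domain (A_det x)).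
apply: (mulmx2_rcancel domain (A_det x)).
rewrite -!mulmxA mul_adj2 [A x *m (M *m _)]mulmxA E -!mulmxA.
rewrite [A x *m (adj2 _ *m _)]mulmxA mul2_adj.
by rewrite !mul_scalar_mx mul_mx_scalar -scalemxAr.
Qed.

Variables (p m : nat) (W : 'I_k -> word 'I_k).
Hypothesis pS : p \in [pchar S]%R.
Hypothesis A_W : forall i, map_mx (fun x => x ^+ (p ^ m))%R (A i) = word_mx A (W i).

Let frob0 (x : S) : (frobenius pS m x = 0 -> x = 0)%R.
Proof.
rewrite frobeniusE; elim: (p ^ m)%N => [/eqP|n IHn]; first by rewrite expr0 oner_eq0.
by rewrite exprS => /domain[].
Qed.

Let frob_inj : injective (fun M : MT => map_mx (frobenius pS m) M : MT).
Proof.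
move=> M N /matrixP MN; apply/matrixP => i j; apply/eqP; rewrite -subr_eq0; apply/eqP/frob0.
by have := MN i j; rewrite !mxE rmorphB /= => ->; rewrite subrr.
Qed.

Let frob : {perm MT} := perm frob_inj.

Let frobE (M : MT) : frob M = map_mx (frobenius pS m) M.
Proof. by rewrite permE. Qed.

(** The Frobenius is multiplicative and carries [A i] to the value of [W i], so it carries
    conjugation by the former to conjugation by the latter. *)
Let frob_conj i : conj_mx i ^ frob = word_val conj_mx (W i).
Proof.
apply/permP => M'; have [M ->] : exists M, M' = frob M by exists (frob^-1 M'); rewrite permKV.
rewrite permJ.
have WE : word_mx A (W i) = map_mx (frobenius pS m) (A i) by rewrite -A_W.
have detW : det2 (word_mx A (W i)) != 0%R.
  by rewrite WE map_det2; apply: contraNneq (A_det i) => /frob0 ->.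
apply: (mulmx2_lcancel domain detW); rewrite conj_word WE !frobE.
by rewrite -!map_mxM conj_mxE.
Qed.

Lemma conjugation_action : exists (L : finType) (c : 'I_k -> {perm L}) (tau : {perm L}),
  (forall i, c i ^ tau = word_val c (W i)) /\
  forall w, word_val c w = 1 -> scalar2 (word_mx A w).
Proof.
exists MT, conj_mx, frob; split=> [|w w1]; first exact: frob_conj.
by apply: scalar2_comm => M; have := conj_word w M; rewrite w1 perm1.
Qed.

End ConjugationAction.

Variables (G : groupType) (phi : {multiplicative G -> G}).
Hypothesis phi_inj : injective phi.

Lemma pi_word_inv (X : choiceType) (w : word X) :
  \pi_(free_group X) (word_inv w) = (\pi_(free_group X) w)^-1.
Proof.
apply: (@mulgI _ (\pi_(free_group X) w)); rewrite mulgV -pi_free_cat.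
exact/word_eqE/word_mulV.
Qed.

Theorem base_detected_by_finite_image (g : G) : free_of_finite_rank G -> g <> 1 ->
  exists (K : groupType) (h : {multiplicative ascending_hnn phi -> K}),
    finite_set [set: K]%classic /\ h (hnn_base phi g) <> 1.
Proof.
move=> [k [iso [inv isoK invK]]] g1.
have invM : {morph inv : x y / x * y} by exact: can2_gmulfM.
have [invm invmE] : exists f : {multiplicative G -> free_group 'I_k}, f =1 inv.
  pose f : {multiplicative G -> free_group 'I_k} :=
    HB.pack inv (isMultiplicative.Build _ _ inv invM).
  by exists f.
have [psi psiE] : exists f : {multiplicative free_group 'I_k -> free_group 'I_k},
    forall x, f x = invm (phi (iso x)).
  by exists (invm \o (phi \o iso)).
have {}isoK x : invm (iso x) = x by rewrite invmE.
have {}invK x : iso (invm x) = x by rewrite invmE.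
pose W i := repr (psi (free_gen i)).
have psi_subst w : \pi_(free_group 'I_k) (word_subst W w) = psi (\pi_(free_group 'I_k) w).
  elim: w => [|[x b] w IHw]; first by rewrite [RHS]multiplicative1.
  rewrite /word_subst /= pi_free_cat -/(word_subst W w) IHw -cat1s pi_free_cat gmulfM.
  congr (_ * _); rewrite pi_free_letter; case: b; rewrite /= ?pi_word_inv /W reprK //.
  by rewrite multiplicativeV.
have psi_iter w j : iter j psi (invm w) = invm (iter j phi w).
  by elim: j => //= j ->; rewrite psiE invK.
pose u := repr (invm g).
have u_iter j : \pi_(free_group 'I_k) (iter j (word_subst W) u) = invm (iter j phi g).
  rewrite -psi_iter; elim: j => [|j IHj]; first by rewrite reprK.
  by rewrite !iterS psi_subst IHj.
(* Injectivity of [phi] keeps all iterates of [g] nontrivial. *)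
have u1 j : ~ word_eq (iter j (word_subst W) u) [::].
  move=> /word_eqE; rewrite u_iter -[RHS](multiplicative1 invm) => /(can_inj invK) gj.
  apply: g1; elim: j gj => [//|j IHj]; rewrite iterS -[X in _ = X](multiplicative1 phi).
  by move/phi_inj.
have [m [S [T [e [A [[pS eS dom] [AW Adet Au]]]]]]] := matrix_point (p := 2) isT u1.
have [L [c [tau [ctau cu]]]] := conjugation_action eS dom Adet pS AW.
pose rho : {multiplicative G -> {perm L}} := free_lift c \o invm.
have rel g' : tau^-1 * rho g' * tau = rho (phi g').
  rewrite -mulgA -/(conjg _ _) /rho /= -[in RHS](invK g') -psiE.
  move: (invm g') => x.
  elim/free_ind: x => [|i x IHx]; first by rewrite !multiplicative1 conj1g.
  have ci : free_lift c (free_gen i) ^ tau = free_lift c (psi (free_gen i)).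
    by rewrite free_lift_gen ctau /free_lift.
  by rewrite !gmulfM !conjMg !multiplicativeV conjVg IHx ci.
have [h [hb ht]] := hnn_lift rel.
exists {perm L}, h; split; first exact: finite_finset.
rewrite hb /rho /= -[invm g]reprK free_lift_pi => /cu.
exact: Au.
Qed.

Theorem ascending_hnn_residually_finite :
  free_of_finite_rank G -> residually_finite (ascending_hnn phi).
Proof.
move=> Gfree x x1; have [a [b [g xE]]] := hnn_normal_form x.
have [ab|ab] := eqVneq a b; last first.
  (* The modulus [(maxn a b).+1] exceeds both exponents and therefore separates them. *)
  have [h [hb ht]] := hnn_exponent phi (maxn a b).
  exists (ker_normal h); first by apply: finite_index_ker; apply: finite_finset.
  rewrite /= xE => /(hnn_exponent_eq hb ht); rewrite !modn_small ?ltnS ?leq_maxl ?leq_maxr //.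
  by move=> E; rewrite E eqxx in ab.
have g1 : g <> 1 by move=> g1; apply: x1; rewrite xE g1 multiplicative1 mulg1 ab mulgV.
have [K [h [finK hg]]] := base_detected_by_finite_image Gfree g1.
exists (ker_normal h); first exact: finite_index_ker.
rewrite /= xE ab !gmulfM multiplicativeV => E; apply: hg.
apply: (@mulgI _ (h (hnn_stable phi ^+ b))); rewrite mulg1.
exact: divg1_eq.
Qed.

End ResidualFiniteness.

(** * Modules and cochains modulo a normal subgroup of finite index *)

Section ZmodReflection.
Import GRing.Theory.
Local Open Scope ring_scope.

Inductive zexpr := ZVar of nat | ZAdd of zexpr & zexpr | ZOpp of zexpr | Zero.

Fixpoint zcoef (e : zexpr) (i : nat) : int :=
  match e with
  | ZVar j => if i == j then 1 else 0
  | ZAdd e1 e2 => zcoef e1 i + zcoef e2 i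
  | ZOpp e1 => - zcoef e1 i
  | Zero => 0
  end.

Fixpoint zvars (e : zexpr) : nat :=
  match e with
  | ZVar j => j.+1
  | ZAdd e1 e2 => maxn (zvars e1) (zvars e2)
  | ZOpp e1 => zvars e1
  | Zero => 0
  end.

Variable V : zmodType.

Fixpoint zdenote (env : seq V) (e : zexpr) : V :=
  match e with
  | ZVar j => env`_j
  | ZAdd e1 e2 => zdenote env e1 + zdenote env e2
  | ZOpp e1 => - zdenote env e1
  | Zero => 0
  end.

Lemma zdenoteE env e n : (zvars e <= n)%N ->
  zdenote env e = \sum_(i < n) env`_i *~ zcoef e i.
Proof.
elim: e => [j|e1 IH1 e2 IH2|e IH|] /=.
- move=> jn; rewrite (bigD1 (Ordinal jn)) //= eqxx big1 ?addr0 // => i ij.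
  by case: eqP => // E; case/eqP: ij; apply/val_inj.
- rewrite geq_max => /andP[/IH1 -> /IH2 ->]; rewrite -big_split /=.
  by apply: eq_bigr => i _; rewrite mulrzDr.
- by move=> /IH ->; rewrite -sumrN; apply: eq_bigr => i _; rewrite mulrNz.
- by rewrite big1.
Qed.

Lemma zreflect env e1 e2 :
  all (fun i => zcoef e1 i == zcoef e2 i) (iota 0 (maxn (zvars e1) (zvars e2))) ->
  zdenote env e1 = zdenote env e2.
Proof.
move=> /allP E; rewrite (zdenoteE _ (leq_maxl _ (zvars e2))) (zdenoteE _ (leq_maxr (zvars e1) _)).
apply: eq_bigr => i _; congr (_ *~ _); apply/eqP/E.
by rewrite mem_iota add0n ltn_ord.
Qed.

End ZmodReflection.

(* Atoms are compared up to conversion: rewriting with [mulgA] leaves products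
   whose group structure is not syntactically the original one. *)
Ltac zindex x env :=
  match env with
  | ?y :: _ => let _ := match goal with _ => unify x y end in constr:(0)
  | _ :: ?env' => let n := zindex x env' in constr:(S n)
  end.

Ltac zatoms t env :=
  lazymatch t with
  | (?a + ?b)%R => let env1 := zatoms a env in zatoms b env1
  | (- ?a)%R => zatoms a env
  | 0%R => env
  | _ => match env with
         | _ => let n := zindex t env in env
         | _ => constr:(t :: env)
         end
  end.

Ltac zreify t env :=
  lazymatch t with
  | (?a + ?b)%R => let x := zreify a env in let y := zreify b env in constr:(ZAdd x y)
  | (- ?a)%R => let x := zreify a env in constr:(ZOpp x)
  | 0%R => constr:(Zero)
  | _ => let n := zindex t env in constr:(ZVar n)
  end.

Ltac zmod :=
  lazymatch goal with
  | |- @eq ?V ?l ?r =>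
    let env0 := zatoms l (@nil V) in
    let env := zatoms r env0 in
    let e1 := zreify l env in
    let e2 := zreify r env in
    exact: (@zreflect _ env e1 e2 isT)
  end.


Section FiniteFunctions.
Local Open Scope classical_set_scope.

Lemma finite_fun (T U : choiceType) :
  finite_set [set: T] -> finite_set [set: U] -> finite_set [set: T -> U].
Proof.
move=> /finite_seqP[s sP] /finite_seqP[r rP].
have sT x : x \in s by have : [set: T] x by []; rewrite sP.
have rU y : y \in r by have : [set: U] y by []; rewrite rP.
pose enc (f : T -> U) : {ffun 'I_(size s) -> 'I_(size r).+1} :=
  [ffun i => inord (index (f (tnth (in_tuple s) i)) r)].
apply: (@finite_inj _ _ enc); last exact: finite_finset.
move=> f g /ffunP fg; apply/funext => x.
have xs : (index x s < size s)%N by rewrite index_mem.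
have := fg (Ordinal xs); rewrite !ffunE (tnth_nth x) /= nth_index // => /(congr1 val).
rewrite /= !inordK ?ltnS ?index_size // => /(congr1 (nth (f x) r)).
by rewrite !nth_index.
Qed.

Lemma finite_prod (T U : Type) :
  finite_set [set: T] -> finite_set [set: U] -> finite_set [set: T * U].
Proof.
move=> finT finU; have := finite_setX finT finU.
suff -> : [set: T] `*` [set: U] = [set: T * U] by [].
by apply/seteqP.
Qed.

End FiniteFunctions.

(** * Finite index of intersections and of kernels of actions *)

Section NormalIntersection.
Local Open Scope group_scope.
Local Open Scope classical_set_scope.
Variable G : groupType.

Lemma normal_setT_finite : exists N : normal_subgroup G, finite_index N.
Proof.
exists (@NormalSubgroup G setT I (fun _ _ _ _ => I) (fun _ _ => I) (fun _ _ _ => I)).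
by apply: (finite_index_fiber (f := fun=> tt)) => //; apply: finite_finset.
Qed.

Variables N M : normal_subgroup G.

Lemma normal_meetM x y : (N `&` M) x -> (N `&` M) y -> (N `&` M) (x * y).
Proof. by move=> [Nx Mx] [Ny My]; split; apply: normalM. Qed.

Lemma normal_meetV x : (N `&` M) x -> (N `&` M) x^-1.
Proof. by move=> [Nx Mx]; split; apply: normalV. Qed.

Lemma normal_meetJ x g : (N `&` M) x -> (N `&` M) (x ^ g).
Proof. by move=> [Nx Mx]; split; apply: normalJ. Qed.

Definition normal_meet : normal_subgroup G := @NormalSubgroup G (N `&` M)
  (conj (normal1 N) (normal1 M)) normal_meetM normal_meetV normal_meetJ.

Lemma finite_index_meet : finite_index N -> finite_index M -> finite_index normal_meet.
Proof.
move=> finN finM.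
apply: (finite_index_fiber (f := fun x => (coset_map N x, coset_map M x))).
  exact: finite_prod.
by move=> x y [/cosetE Nxy /cosetE Mxy].
Qed.

End NormalIntersection.

Section ModuleKernel.
Import GRing.Theory.
Local Open Scope ring_scope.
Local Open Scope group_scope.
Local Open Scope classical_set_scope.
Variables (G : groupType) (A : gmodule G).
Implicit Types (g h : G) (a b : A).

Lemma gact0 g : gact g (0 : A) = 0.
Proof. by have := gactB g (0 : A) 0; rewrite !subrr. Qed.

Lemma gactN g a : gact g (- a)%R = (- gact g a)%R.
Proof. by rewrite -sub0r gactB gact0 sub0r. Qed.

Lemma gactKV g a : gact g (gact g^-1 a) = a.
Proof. by rewrite -gactM mulgV gact1. Qed.

Lemma gactVK g a : gact g^-1 (gact g a) = a.
Proof. by rewrite -gactM mulVg gact1. Qed.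

Definition acts_trivially : set G := [set g | forall a, gact g a = a].

Lemma acts_trivially1 : acts_trivially 1.
Proof. by move=> a; rewrite gact1. Qed.

Lemma acts_triviallyM g h : acts_trivially g -> acts_trivially h -> acts_trivially (g * h).
Proof. by move=> tg th a; rewrite gactM th tg. Qed.

Lemma acts_triviallyV g : acts_trivially g -> acts_trivially g^-1.
Proof. by move=> tg a; rewrite -{1}(tg a) gactVK. Qed.

Lemma acts_triviallyJ g h : acts_trivially g -> acts_trivially (g ^ h).
Proof. by move=> tg a; rewrite /conjg !gactM tg gactVK. Qed.

Definition action_kernel : normal_subgroup G := NormalSubgroup
  acts_trivially1 acts_triviallyM acts_triviallyV acts_triviallyJ.

Lemma gact_kernel g h a : normal_set action_kernel (g^-1 * h) -> gact g a = gact h a.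
Proof. by move=> /(_ a) E; rewrite -{1}E gactM gactKV. Qed.

Lemma finite_index_action_kernel : finite_set [set: A] -> finite_index action_kernel.
Proof.
move=> finA; apply: (finite_index_fiber (f := fun g => (gact g : A -> A))).
  exact: finite_fun.
by move=> g h gh a; rewrite gactM -gh gactVK.
Qed.

End ModuleKernel.

(** * Bar cochains of low degree and their invariance *)

Section BarComplex.
Import GRing.Theory.
Local Open Scope ring_scope.
Local Open Scope group_scope.
Local Open Scope classical_set_scope.
Variables (G : groupType) (A : gmodule G).
Implicit Types (N M : normal_subgroup G).

Definition bar1 (k : G -> A) a b : A := (gact a (k b) - k (a * b)%g + k a)%R.

Definition bar2 (f : G -> G -> A) a b c : A :=
  (gact a (f b c) - f (a * b)%g c + f a (b * c)%g - f a b)%R.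

Definition bar3 (f : G -> G -> G -> A) a b c d : A :=
  (gact a (f b c d) - f (a * b)%g c d + f a (b * c)%g d - f a b (c * d)%g + f a b c)%R.

Lemma bar2_bar1 k a b c : bar2 (bar1 k) a b c = 0%R.
Proof. by rewrite /bar2 /bar1 !(gactD, gactN) !gactM !mulgA; zmod. Qed.

Lemma bar2D f f' a b c :
  bar2 (fun x y => f x y + f' x y)%R a b c = (bar2 f a b c + bar2 f' a b c)%R.
Proof. rewrite /bar2 !(gactD, gactN); zmod. Qed.

Lemma bar2N f a b c : bar2 (fun x y => - f x y)%R a b c = (- bar2 f a b c)%R.
Proof. rewrite /bar2 !(gactD, gactN); zmod. Qed.

Definition invariant2 (T : Type) N (f : G -> G -> T) := forall x x' y y',
  normal_set N (x^-1 * x') -> normal_set N (y^-1 * y') -> f x y = f x' y'.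

Definition invariant3 (T : Type) N (f : G -> G -> G -> T) := forall x x' y y' z z',
  normal_set N (x^-1 * x') -> normal_set N (y^-1 * y') -> normal_set N (z^-1 * z') ->
  f x y z = f x' y' z'.

(* For [n] in [N], where [f = f 1 1 =: c], the cochain [k] satisfies
   [x (k n - c) = k (x n) - k x] modulo [C]; so it is invariant under those [n]
   with [k n - c] in [C], and these form a normal subgroup. *)
Lemma coboundary_invariant (C : set A) N (k : G -> A) (f : G -> G -> A) :
  finite_set [set: A] -> C 0%R -> (forall u v, C u -> C v -> C (u - v)%R) ->
  (forall g u, C u -> C (gact g u)) ->
  finite_index N -> N `<=` action_kernel A -> invariant2 N f ->
  (forall a b, C (bar1 k a b - f a b)%R) ->
  exists M, [/\ finite_index M, M `<=` N & forall x y, normal_set M (x^-1 * y) -> C (k y - k x)%R].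
Proof.
move=> finA C0 CB Cact finN Nker fN kf.
have CN u : C u -> C (- u)%R by move=> Cu; rewrite -sub0r; apply: CB.
have CD u v : C u -> C v -> C (u + v)%R by move=> Cu Cv; rewrite -[v]opprK; apply/CB/CN.
pose c := f 1 1.
have transl x n : normal_set N n ->
    C (k (x * n)%g - k x - gact x (k n - c))%R.
  move=> Nn; have kxn := kf x n; have kx1 := kf x 1.
  have fx : f x n = f x 1 by apply: fN; rewrite ?mulVg ?mulg1; [exact: normal1|exact: normalV].
  have k1 := Cact x _ (kf 1 1); rewrite /bar1 gact1 mulg1 -/c in k1.
  rewrite /bar1 mulg1 fx in kxn kx1.
  have := CB _ _ (CB _ _ kx1 k1) kxn; congr (C _).
  rewrite !(gactD, gactN); zmod.
have k1 : C (k 1%g - c)%R.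
  have := kf 1 1; rewrite /bar1 gact1 mulg1 -/c; congr (C _); zmod.
have translC n x : normal_set N n -> C (k (n * x)%g - k x - (k n - c))%R.
  move=> Nn; have knx := kf n x; have k1x := kf 1 x.
  have fx : f n x = f 1 x by apply: fN; rewrite ?mulVg ?mulg1; [exact: normalV|exact: normal1].
  rewrite /bar1 fx (Nker n Nn) in knx; rewrite /bar1 gact1 mul1g in k1x.
  have := CB _ _ (CB _ _ k1x k1) knx; congr (C _); zmod.
pose P n := normal_set N n /\ C (k n - c)%R.
have P1 : P 1 by split => //; exact: normal1.
have PM n m : P n -> P m -> P (n * m).
  move=> [Nn Cn] [Nm Cm]; split; first exact: normalM.
  have := CD _ _ (CD _ _ (transl n m Nm) (Cact n _ Cm)) Cn; congr (C _); zmod.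
have PV n : P n -> P n^-1.
  move=> [Nn Cn]; split; first exact: normalV.
  have := CB _ _ (CB _ _ k1 (transl n^-1 n Nn)) (Cact n^-1 _ Cn); rewrite mulVg.
  congr (C _); zmod.
have PJ n x : P n -> P (n ^ x).
  move=> [Nn Cn]; split; first exact: normalJ.
  have NJ := normalJ x Nn; have := transl x _ NJ; have := translC n x Nn.
  have -> : x * n ^ x = n * x by rewrite /conjg mulVKg.
  move=> C1 C2; have := Cact x^-1 _ (CD _ _ (CB _ _ C1 C2) Cn).
  rewrite -[X in _ -> C X](gactVK x); congr (C (gact _ _)); zmod.
pose M := @NormalSubgroup G P P1 PM PV PJ.
exists M; split.
(* The coset modulo [N] and the value of [k], finitely many pairs, determine the coset modulo
   [M]. *)
- apply: (finite_index_fiber (f := fun x => (coset_map N x, k x))).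
    exact: finite_prod.
  move=> x y [/cosetE Nxy kxy]; split => //.
  have := transl x _ Nxy; rewrite mulVKg -kxy subrr sub0r => /CN.
  by rewrite opprK => /(Cact x^-1); rewrite gactVK.
- by move=> n [].
move=> x y [Nxy Cxy]; have := CD _ _ (transl x _ Nxy) (Cact x _ Cxy).
rewrite mulVKg; congr (C _); zmod.
Qed.

End BarComplex.

(** * Coefficients in functions on a finite set with group action *)

Section FunctionModule.
Import GRing.Theory.
Local Open Scope ring_scope.
Local Open Scope group_scope.
Local Open Scope classical_set_scope.
Variables (G : groupType) (A : gmodule G) (X : choiceType) (act : G -> X -> X).
Hypothesis act1 : forall x, act 1 x = x.
Hypothesis actM : forall g h x, act (g * h) x = act g (act h x).

Let fact (g : G) (u : X -> A) : X -> A := fun x => gact g (u (act g^-1 x)).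

Let fact1 u : fact 1 u = u.
Proof. by apply/funext => x; rewrite /fact gact1 invg1 act1. Qed.

Let factM g h u : fact (g * h) u = fact g (fact h u).
Proof. by apply/funext => x; rewrite /fact gactM invgM actM. Qed.

Let factD g (u v : X -> A) : fact g (u + v)%R = (fact g u + fact g v)%R.
Proof. by apply/funext => x; rewrite /fact gactD. Qed.

Definition function_module : gmodule G := GModule fact1 factM factD.

Lemma function_gactE g (u : function_module) x :
  gact g u x = gact g ((u : X -> A) (act g^-1 x)).
Proof. by []. Qed.

Hypothesis finX : finite_set [set: X].
Hypothesis finA : finite_set [set: A].

Lemma finite_function_module : finite_set [set: function_module].
Proof. exact: finite_fun. Qed.

(* If [h] becomes cohomologous, by [k], to an invariant cochain after enlarging
   the coefficients from [A] to [X -> A], then subtracting from [k] the invariant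
   cochain [k - k x0] shows that [k x0] makes [h] invariant already in [A]. *)
Lemma invariant_descent (x0 : X) (h : G -> G -> A) (k : G -> X -> A)
  (f : G -> G -> X -> A) (N : normal_subgroup G) :
  finite_index N -> invariant2 N f ->
  (forall a b x, f a b x = (h a b + @bar1 G function_module k a b x)%R) ->
  exists (kappa : G -> A) (M : normal_subgroup G),
    finite_index M /\ invariant2 M (fun a b => h a b + bar1 kappa a b)%R.
Proof.
move=> finN fN fE; pose B := function_module.
pose N' := normal_meet N (action_kernel B).
have finN' : finite_index N'.
  by apply: finite_index_meet finN (finite_index_action_kernel finite_function_module).
(* [C] consists of the constant functions. The values of [h] are such, so [bar1 k] agrees modulo [C]
   with the invariant cochain [f]. *)
pose C : set B := fun u => forall x, u x = u x0.
have CB (u v : B) : C u -> C v -> C (u - v)%R.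
  move=> Cu Cv x; have E y : (u - v)%R y = (u y - v y)%R by [].
  by rewrite !E Cu Cv.
have Cact g (u : B) : C u -> C (gact g u).
  by move=> Cu x; rewrite !function_gactE Cu [in RHS]Cu.
have fN' : invariant2 N' f by move=> x x' y y' [Nx _] [Ny _]; apply: fN.
have kf a b : C (bar1 (A := B) k a b - f a b)%R.
  move=> x; have E y : (bar1 (A := B) k a b - f a b)%R y = (- h a b)%R.
    have -> : (bar1 (A := B) k a b - f a b)%R y = (bar1 (A := B) k a b y - f a b y)%R by [].
    by rewrite fE; zmod.
  by rewrite !E.
have [|M [finM MN Mk]] := coboundary_invariant finite_function_module _ CB Cact finN'
  (fun n nN' => proj2 nN') fN' kf; first by [].
exists (fun a => k a x0), M; split=> // a a' b b' Maa' Mbb'.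
(* The right side involves only data invariant modulo [M]: the cochain [f], the action, and [k d] up
   to its value at [x0]. *)
have E c d : (h c d + bar1 (fun a => k a x0) c d =
    f c d x0 - (gact c ((k d : B) - (fun=> k d x0))%R : X -> A) x0)%R.
  rewrite fE; have -> : bar1 (A := B) k c d x0 =
      (gact c (k d (act c^-1 x0)) - k (c * d)%g x0 + k c x0)%R by [].
  rewrite function_gactE /bar1.
  have -> : ((k d : B) - (fun=> k d x0))%R (act c^-1 x0) =
    (k d (act c^-1 x0) - k d x0)%R by [].
  rewrite gactB; zmod.
have [Naa' keraa'] := MN _ Maa'; have [Nbb' _] := MN _ Mbb'.
rewrite !E (fN _ _ _ _ Naa' Nbb') (gact_kernel _ keraa').
suff -> : ((k b : B) - (fun=> k b x0))%R = ((k b' : B) - (fun=> k b' x0))%R by [].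
apply/funext => x.
have := Mk _ _ Mbb' x.
have F y : ((k b' : B) - k b)%R y = (k b' y - k b y)%R by [].
have F' c : ((k c : B) - (fun=> k c x0))%R x = (k c x - k c x0)%R by [].
rewrite !F !F' => H; apply/eqP; rewrite eq_sym -subr_eq0; apply/eqP.
transitivity ((k b' x - k b x) - (k b' x0 - k b x0))%R; first zmod.
by rewrite H subrr.
Qed.

End FunctionModule.

(** * Dimension shifting for the third cohomology *)

Section ThirdCohomology.
Import GRing.Theory.
Local Open Scope ring_scope.
Local Open Scope group_scope.
Local Open Scope classical_set_scope.
Variable G : groupType.

(* Surjectivity in degree 2 of the comparison map, in terms of cochains. *)
Definition two_cocycles_invariant := forall (A : gmodule G) (f : G -> G -> A),
  finite_set [set: A] -> (forall a b c, bar2 f a b c = 0%R) ->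
  exists (k : G -> A) (M : normal_subgroup G),
    finite_index M /\ invariant2 M (fun a b => f a b + bar1 k a b)%R.

(** With coefficients in functions on a finite quotient, [f] is the coboundary of an explicit
    invariant [F]. Then [h - F] is a 2-cocycle, which some [bar1 k] makes invariant; so [h + bar1 k]
    is invariant, and [invariant_descent] returns to [A]. *)
Lemma invariant_three_coboundary (A : gmodule G) (f : G -> G -> G -> A)
  (h : G -> G -> A) (N : normal_subgroup G) :
  two_cocycles_invariant -> finite_set [set: A] -> finite_index N -> invariant3 N f ->
  (forall a b c, bar2 h a b c = f a b c) ->
  exists (h' : G -> G -> A) (M : normal_subgroup G),
    [/\ finite_index M, invariant2 M h' & forall a b c, bar2 h' a b c = f a b c].
Proof.
move=> H2 finA finN0 fN0 hf.
pose N1 := normal_meet N (action_kernel A).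
have finN : finite_index N1.
  by apply: finite_index_meet finN0 (finite_index_action_kernel finA).
have fN : invariant3 N1 f.
  by move=> x x' y y' z z' [Nx _] [Ny _] [Nz _]; apply: fN0.
have fcocycle a b c d : bar3 f a b c d = 0%R.
  rewrite /bar3 -!hf /bar2 !(gactD, gactN) !gactM !mulgA; zmod.
pose X : choiceType := quotient_group N1.
pose act (g : G) (x : X) : X := coset_map N1 g * x.
have act1 x : act 1 x = x by rewrite /act multiplicative1 mul1g.
have actM g g' x : act (g * g') x = act g (act g' x) by rewrite /act gmulfM mulgA.
pose B := function_module A act1 actM.
pose phi (g a b : G) : A := gact g (f g^-1 a b).
have N1refl a : normal_set N1 (a^-1 * a) by rewrite mulVg; apply: normal1.
have phiN g g' a a' b b' : normal_set N1 (g^-1 * g') -> normal_set N1 (a^-1 * a') ->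
    normal_set N1 (b^-1 * b') -> phi g a b = phi g' a' b'.
  move=> Ng Na Nb; rewrite /phi (gact_kernel _ (proj2 Ng)); congr gact; apply: fN => //.
  rewrite invgK; have := normalJ g^-1 (normalV Ng).
  by rewrite /conjg invgM !invgK mulgK.
(* The contracting homotopy [x f(x^-1, a, b)] of induced coefficients; the cocycle identity at
   [(x^-1, a, b, c)] shows that its coboundary is [f]. *)
pose F (a b : G) (x : X) : A := phi (repr x) a b.
have FE g a b : F a b (coset_map N1 g) = phi g a b.
  by apply: phiN => //; apply/cosetE; rewrite reprK.
have F2 a b c x : bar2 (A := B) F a b c x = f a b c.
  have -> : bar2 (A := B) F a b c x = (gact a (F b c (act a^-1%g x)) - F (a * b)%g c x
    + F a (b * c)%g x - F a b x)%R by [].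
  rewrite -[x]reprK -/(coset_map N1 (repr x)); move: (repr x) => g.
  rewrite /act -gmulfM !FE /phi -gactM mulgA mulgV mul1g invgM invgK.
  have := congr1 (gact g) (fcocycle g^-1 a b c).
  rewrite /bar3 !(gactD, gactN) gact0 gactKV => E.
  by rewrite -[RHS]addr0 -[in RHS](oppr0) -E; zmod.
have FN : invariant2 N1 F.
  by move=> a a' b b' Na Nb; apply/funext => x; apply: phiN.
pose psi (a b : G) : B := (((fun=> h a b) : X -> A) + - (F a b : B))%R.
have psi2 a b c : bar2 psi a b c = 0%R.
  rewrite (bar2D (A := B)) (bar2N (A := B)); apply/funext => x.
  have -> : (bar2 (A := B) (fun a b => (fun=> h a b)) a b c - bar2 (A := B) F a b c)%R x =
    (bar2 h a b c - bar2 (A := B) F a b c x)%R by [].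
  by rewrite F2 hf subrr.
have finX : finite_set [set: X] by exact: finN.
have [k [M [finM Mpsi]]] := H2 B psi (finite_function_module act1 actM finX finA) psi2.
pose f' a b : X -> A := ((psi a b + bar1 (A := B) k a b) + (F a b : B))%R.
pose M' := normal_meet M N1.
have f'M : invariant2 M' f'.
  by move=> a a' b b' [Ma Na] [Mb Nb]; rewrite /f' (Mpsi a a' b b') // (FN a a' b b').
have f'E a b x : f' a b x = (h a b + bar1 (A := B) k a b x)%R.
  have -> : f' a b x = (h a b - F a b x + bar1 (A := B) k a b x + F a b x)%R by [].
  zmod.
have [kappa [M2 [finM2 hM2]]] :=
  invariant_descent finX finA (1 : X) (finite_index_meet finM finN) f'M f'E.
exists (fun a b => h a b + bar1 kappa a b)%R, M2; split=> // a b c.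
by rewrite bar2D bar2_bar1 addr0 hf.
Qed.

End ThirdCohomology.

(** * Second cohomology of an ascending HNN extension *)

Section Extension.
Import GRing.Theory.
Local Open Scope ring_scope.
Local Open Scope group_scope.
Variables (G : groupType) (A : gmodule G) (f : G -> G -> A).

Definition extension of (forall a b c, bar2 f a b c = 0%R) : Type := (A * G)%type.

Hypothesis fc : forall a b c, bar2 f a b c = 0%R.
Local Notation E := (extension fc).
HB.instance Definition _ := Choice.on E.

Definition ext_mul (x y : E) : E := ((x.1 + gact x.2 y.1 + f x.2 y.2)%R, x.2 * y.2).
(** The first coordinate is not 0 in general, as the cocycle need not be normalized. *)
Definition ext_one : E := ((- f 1%g 1%g)%R, 1).
Definition ext_inv (x : E) : E :=
  ((- f 1%g 1%g - f x.2^-1%g x.2 - gact x.2^-1%g x.1)%R, x.2^-1).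

Lemma ext_mulA : associative ext_mul.
Proof.
move=> [a x] [b y] [c z]; rewrite /ext_mul /= !gactD gactM mulgA; congr (_, _).
apply/eqP; rewrite -subr_eq0; apply/eqP; rewrite -(fc x y z) /bar2; zmod.
Qed.

Lemma cocycle1l x : f 1 x = f 1 1.
Proof.
apply/eqP; rewrite -subr_eq0; apply/eqP; rewrite -(fc 1 1 x) /bar2 gact1 !mul1g; zmod.
Qed.

Lemma cocycle1r x : f x 1 = gact x (f 1 1).
Proof.
apply/eqP; rewrite eq_sym -subr_eq0; apply/eqP; rewrite -(fc x 1 1) /bar2 !mulg1; zmod.
Qed.

Lemma ext_mul1 : left_id ext_one ext_mul.
Proof.
move=> [a x]; rewrite /ext_mul /= gact1 cocycle1l mul1g; congr (_, _); zmod.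
Qed.

Lemma ext_mulr1 : right_id ext_one ext_mul.
Proof.
move=> [a x]; rewrite /ext_mul /= gactN (cocycle1r x) mulg1; congr (_, _); zmod.
Qed.

Lemma ext_mulVg : left_inverse ext_one ext_inv ext_mul.
Proof.
move=> [a x]; rewrite /ext_mul /= mulVg; congr (_, _); zmod.
Qed.

Lemma ext_mulgV : right_inverse ext_one ext_inv ext_mul.
Proof.
move=> [a x]; rewrite /ext_mul /= mulgV; congr (_, _).
rewrite !(gactD, gactN) gactKV; apply/eqP; rewrite -subr_eq0; apply/eqP.
have := fc x x^-1 x; rewrite /bar2 mulgV mulVg (cocycle1l x) (cocycle1r x) => E.
rewrite -[RHS]oppr0 -[in RHS]E; zmod.
Qed.

HB.instance Definition _ := isGroup.Build E ext_mulA ext_mul1 ext_mulr1 ext_mulVg ext_mulgV.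

Definition ext_proj (x : E) : G := x.2.

Lemma ext_projM : {morph ext_proj : x y / x * y}.
Proof. by []. Qed.

HB.instance Definition _ := isMultiplicative.Build _ _ ext_proj ext_projM.

(** The first coordinate [k] of a splitting satisfies [k (a * b) = k a + a (k b) + f a b]. *)
Lemma splitting_trivializes (s : {multiplicative G -> E}) :
  (forall x, ext_proj (s x) = x) -> exists k : G -> A, forall a b, (f a b + bar1 k a b = 0)%R.
Proof.
move=> sp; exists (fun x => (s x).1) => a b.
have := @gmulfM _ _ s a b => /(congr1 fst) /= E; rewrite /bar1 [in LHS]E.
have sE x : (s x).2 = x := sp x.
rewrite !sE; zmod.
Qed.

End Extension.

Lemma periodic_point (V : Type) (T : V -> V) (v0 : V) : finite_set [set: V]%classic ->
  exists (v : V) (m : nat), iter m.+1 T v = v.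
Proof.
move=> finV; apply: contrapT => noper.
have inj : injective (fun i => iter i T v0).
  have lt i j : (i < j)%N -> iter i T v0 = iter j T v0 -> False.
    move=> ij E; apply: noper; exists (iter i T v0), (j - i).-1.
    by rewrite prednK ?subn_gt0 // -iterD subnK // ltnW.
  by move=> i j E; case: (ltngtP i j) => // ij; [case: (lt i j)|case: (lt j i)].
by have := finite_inj inj finV; exact: infinite_nat.
Qed.

Section HNNSecondCohomology.
Import GRing.Theory.
Local Open Scope ring_scope.
Local Open Scope group_scope.
Local Open Scope classical_set_scope.
Variables (n : nat) (G : groupType) (iso : {multiplicative free_group 'I_n -> G}).
Variable (phi : {multiplicative G -> G}).
Hypothesis iso_bij : bijective iso.
Local Notation Gam := (ascending_hnn phi).
Variables (A : gmodule Gam) (f : Gam -> Gam -> A).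
Hypothesis finA : finite_set [set: A].
Hypothesis fc : forall a b c, bar2 f a b c = 0%R.
Local Notation E := (extension fc).

Let base := hnn_base phi.
Let t := hnn_stable phi.

(** As [G] is free, a lift of the base is an arbitrary choice of coordinates in [A] at the
    generators, so there are finitely many lifts. *)
Lemma base_lifts : exists sigma : ('I_n -> A) -> {multiplicative G -> E},
  (forall v g, ext_proj (sigma v g) = base g) /\
  forall v i, (sigma v (iso (free_gen i))).1 = v i.
Proof.
have [inv isoK invK] := iso_bij.
have invM : {morph inv : x y / x * y} by exact: can2_gmulfM.
pose invm : {multiplicative G -> free_group 'I_n} :=
  HB.pack inv (isMultiplicative.Build _ _ inv invM).
pose lift v i : E := (v i, base (iso (free_gen i))).
exists (fun v => free_lift (lift v) \o invm : {multiplicative G -> E}); split=> v.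
  move=> g; rewrite -[in RHS](invK g) /=; move: (inv g) => x.
  rewrite -[LHS]/((@ext_proj _ _ _ fc \o free_lift (lift v)) x) -[RHS]/((base \o iso) x).
  by apply: free_ext => i /=; rewrite free_lift_gen.
by move=> i; rewrite /= isoK free_lift_gen.
Qed.

Lemma base_lift_ext (s s' : {multiplicative G -> E}) :
  (forall i, s (iso (free_gen i)) = s' (iso (free_gen i))) -> s =1 s'.
Proof.
have [inv isoK invK] := iso_bij; move=> ss' g; rewrite -(invK g).
exact: (free_ext (f := s \o iso) (h := s' \o iso)).
Qed.

(* Conjugating a lift of the base by a lift of the stable letter, and composing
   with [phi], gives another lift. There are finitely many lifts, so one of them
   is periodic; its cycle is a lift, invariant under this operation, to the
   extension obtained by inducing the coefficients from the preimage of [mZ]. *)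
Lemma hnn_two_cocycle_invariant : exists (k : Gam -> A) (M : normal_subgroup Gam),
    finite_index M /\ invariant2 M (fun a b => f a b + bar1 k a b)%R.
Proof.
have [sigma [sigma_base sigma_gen]] := base_lifts.
pose tau : E := (0%R, t).
pose T v i := (tau * sigma v (phi (iso (free_gen i))) * tau^-1).1.
have projT v g : ext_proj (tau * sigma v (phi g) * tau^-1) = base g.
  rewrite -[LHS]/(t * ext_proj (sigma v (phi g)) * t^-1) sigma_base.
  by rewrite -[base (phi g)]hnn_relation -/t -/base !mulgA mulgV mul1g mulgK.
have sigmaT v g : sigma (T v) g = tau * sigma v (phi g) * tau^-1.
  have cM : {morph (fun g => tau * sigma v (phi g) * tau^-1) : x y / x * y}.
    by move=> x y; rewrite !gmulfM !mulgA mulgVK.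
  pose c : {multiplicative G -> E} :=
    HB.pack (fun g => tau * sigma v (phi g) * tau^-1) (isMultiplicative.Build _ _ _ cM).
  apply: (base_lift_ext (s' := c)) => i; apply: injective_projections.
    by rewrite sigma_gen.
  by rewrite -[RHS]/(ext_proj _) projT -[LHS]/(ext_proj _) sigma_base.
have [v [m vm]] : exists (v : 'I_n -> A) (m : nat), iter m.+1 T v = v.
  by apply: (periodic_point _ (fun=> 0%R)); apply: finite_fun => //; exact: finite_finset.
have [e [eb et]] := hnn_exponent phi m.
pose X := 'I_m.+1.
pose act (g : Gam) (x : X) : X := (e g * x)%g.
have act1 x : act 1 x = x by rewrite /act multiplicative1 mul1g.
have actM g h x : act (g * h) x = act g (act h x) by rewrite /act gmulfM mulgA.
pose B := function_module A act1 actM.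
have finX : finite_set [set: X] by exact: finite_finset.
pose F (a b : Gam) : B := (fun=> f a b).
have Fc a b c : bar2 F a b c = 0%R.
  by apply/funext => x; rewrite -[RHS](fc a b c).
(* The coordinate at [x] is the [x]-th lift of the cycle. The base acts trivially on [X], so the
   coordinates are multiplied separately. *)
pose sg (x : X) := sigma (iter x T v).
have sgE x g : (sg x g).2 = base g := sigma_base _ g.
pose s g : extension Fc := ((fun x => (sg x g).1), base g).
have sM : {morph s : g h / g * h}.
  move=> g h; apply: injective_projections; last exact: hnn_baseM.
  apply/funext => x; rewrite /s /=.
  have := @gmulfM _ _ (sg x) g h => /(congr1 fst) /= ->; rewrite !sgE.
  rewrite -[RHS]/((sg x g).1 + gact (base g) ((sg (act (base g)^-1%g x) h).1)
    + f (base g) (base h))%R.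
  by rewrite /act multiplicativeV eb invg1 mul1g.
pose sm : {multiplicative G -> extension Fc} :=
  HB.pack s (isMultiplicative.Build _ _ s sM).
pose tau' : extension Fc := ((fun=> 0%R), t).
have rel g : tau'^-1 * sm g * tau' = sm (phi g).
  apply: (@mulgI _ tau'); rewrite -mulgA mulVKg.
  apply: injective_projections; last first.
    rewrite -[LHS]/(base g * t) -[RHS]/(t * base (phi g)).
    by rewrite -[base (phi g)]hnn_relation !mulgA mulgV mul1g.
  apply/funext => x.
  pose y := act t^-1 x.
  (* [y] is the predecessor of [x] modulo [m.+1]; the passage from [m] to 0 uses the periodicity of
     [v]. *)
  have xy : sg x = sigma (T (iter y T v)).
    rewrite /sg -iterS; congr sigma.
    have -> : x = (Zp1 : X) * y.
      by rewrite /y /act multiplicativeV et mulVKg.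
    have -> : val ((Zp1 : X) * y) = (y.+1 %% m.+1)%N.
      by rewrite -[LHS]/((1 %% m.+1 + y) %% m.+1)%N modnDml add1n.
    have [ym|ym] := ltnP y m; first by rewrite modn_small.
    have -> : val y = m by apply/eqP; rewrite eqn_leq ym -ltnS ltn_ord.
    by rewrite modnn vm.
  have := sigmaT (iter y T v) g; rewrite -xy => /(congr1 (fun z => z * tau)).
  rewrite mulgVK => /(congr1 fst) /=; rewrite sgE => E1.
  by apply: etrans E1 _; congr (_ + f t _)%R; apply: sigma_base.
have [h [hb ht]] := hnn_lift rel.
have hp x : ext_proj (h x) = x.
  apply: (hnn_ext (f := @ext_proj _ _ _ Fc \o h) (h := idfun)) => [g|] /=.
    by rewrite hb.
  by rewrite ht.
have [k kF] := splitting_trivializes hp.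
(* [F + bar1 k] is zero, which is invariant modulo any [N]. *)
have [N finN] := normal_setT_finite Gam.
have zero : invariant2 N (fun (_ _ : Gam) (_ : X) => 0%R : A) by [].
apply: (invariant_descent (act1 := act1) (actM := actM) (h := f) (k := k)
  finX finA (1 : X) finN zero) => a b x.
by rewrite -[RHS]/((F a b + bar1 (A := B) k a b)%R x) kF.
Qed.

End HNNSecondCohomology.

(** * The topology of the profinite completion *)

Section ProfiniteTopology.
Local Open Scope group_scope.
Local Open Scope classical_set_scope.
Variable G : groupType.
Local Notation P := (profinite_completion G).

Lemma fin_normal_meet (N M : fin_normal G) :
  exists K : fin_normal G, sval K `<=` sval N /\ sval K `<=` sval M.
Proof.
exists (exist _ _ (finite_index_meet (svalP N) (svalP M))).
by split=> x [].
Qed.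

Lemma profinite_proj_sub (N M : fin_normal G) (x y : P) : sval N `<=` sval M ->
  profinite_proj x N = profinite_proj y N -> profinite_proj x M = profinite_proj y M.
Proof. by move=> NM E; rewrite -(profinite_projP x NM) -(profinite_projP y NM) E. Qed.

Definition congruent n (N : fin_normal G) (x y : 'I_n -> P) :=
  forall j, profinite_proj (x j) N = profinite_proj (y j) N.

Lemma congruent_sub n (N M : fin_normal G) (x y : 'I_n -> P) : sval N `<=` sval M ->
  congruent N x y -> congruent M x y.
Proof. by move=> NM xy j; apply: profinite_proj_sub (xy j). Qed.

Lemma cvg_profinite (F : set_system P) (x : P) : Filter F ->
  (forall N, F [set y | profinite_proj y N = profinite_proj x N]) -> F --> x.
Proof.
move=> FF Fx U [_ [[W oW <-] Wx] WU]; apply: (filterS WU) => /=.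
pose F' : set_system (finite_quotients G) := [set A | F (set_val @^-1` A)].
have FF' : Filter F'.
  split; first exact: filterT.
    by move=> A B FA FB; exact: (filterI FA FB).
  by move=> A B AB; apply: filterS => y /=; apply: AB.
have : F' --> (set_val x : finite_quotients G).
  apply/cvg_sup => N A [_ [[B _ <-] Bx] BA].
  rewrite nbhs_filterE /F' /=; apply: filterS (Fx N) => y /= yx; apply: BA.
  by rewrite /= -[set_val y N]/(profinite_proj y N) yx.
by apply; apply: open_nbhs_nbhs.
Qed.

Lemma nbhs_profinite_proj (x : P) (N : fin_normal G) :
  nbhs x [set y | profinite_proj y N = profinite_proj x N].
Proof.
have cvx : nbhs (set_val x : finite_quotients G) --> (set_val x : finite_quotients G) by [].
have /cvg_sup/(_ N) := cvx.
move=> /(_ [set y | y N = set_val x N]) H.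
have C : continuous (set_val : P -> finite_quotients G) by exact: initial_continuous.
apply: (C x [set y | y N = set_val x N]); apply: H.
exists [set y | y N = set_val x N]; split=> //.
exists [set a | a = set_val x N] => //.
exact: (@discrete_open (discrete_topology (quotient_group (sval N)))).
Qed.

(** The sets containing the fibre through [x] of some projection form a filter, because finite index
    is stable under intersection; it converges to [x], hence contains all neighbourhoods. *)
Lemma profinite_nbhs (x : P) (U : set P) : nbhs x U ->
  exists N, forall y, profinite_proj y N = profinite_proj x N -> U y.
Proof.
pose F : set_system P := fun U => exists N, forall y,
  profinite_proj y N = profinite_proj x N -> U y.
have FF : Filter F.
  split=> [|A B [N NA] [M MB]|A B AB [N NA]].
  - by have [N finN] := normal_setT_finite G; exists (exist _ N finN).
  - have [K [KN KM]] := fin_normal_meet N M; exists K => y yx.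
    by split; [apply/NA/(profinite_proj_sub KN)|apply/MB/(profinite_proj_sub KM)].
  - by exists N => y /NA; apply: AB.
suff : F --> x by apply.
by apply: cvg_profinite => N; exists N.
Qed.

Section Power.
Variable n : nat.
Local Notation V := {ptws 'I_n -> P}.

Lemma nbhs_congruent (x : V) (N : fin_normal G) : nbhs x [set y | congruent N y x].
Proof.
have FF : Filter (nbhs (x : V)) by exact: nbhs_filter.
apply: (@filter_forall V 'I_n
  (fun j => [set y : V | profinite_proj (y j) N = profinite_proj (x j) N]) _ FF).
move=> j; have cvx : nbhs (x : V) --> (x : V) by [].
have /cvg_sup/(_ j) := cvx; apply.
have C : continuous ((fun y => y j) : initial_topology (fun y : 'I_n -> P => y j) -> P).
  exact: initial_continuous.
exact: (C x _ (nbhs_profinite_proj (x j) N)).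
Qed.

Lemma congruent_nbhs (x : V) (U : set V) : nbhs x U ->
  exists N, forall y, congruent N y x -> U y.
Proof.
pose F : set_system V := fun U => exists N, forall y, congruent N y x -> U y.
have FF : Filter F.
  split=> [|A B [N NA] [M MB]|A B AB [N NA]].
  - by have [N finN] := normal_setT_finite G; exists (exist _ N finN).
  - have [K [KN KM]] := fin_normal_meet N M; exists K => y yx.
    by split; [apply/NA/(congruent_sub KN)|apply/MB/(congruent_sub KM)].
  - by exists N => y /NA; apply: AB.
suff : F --> (x : V) by apply.
apply/cvg_sup => j A [_ [[B oB <-] Bx] BA]; rewrite nbhs_filterE.
apply: filterS BA _ => /=.
have [N NB] := profinite_nbhs (open_nbhs_nbhs (conj oB Bx)).
by exists N => y yx; apply/NB/yx.
Qed.

(* The uniformity is the compactness of the power of the profinite completion: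
   along an ultrafilter finer than the tails of the normal subgroups, a family of
   counterexamples has a limit, and local constancy fails there. *)
Lemma uniformly_congruent (T : Type) (f : V -> T) :
  (forall x, exists N, forall y, congruent N y x -> f y = f x) ->
  exists N, forall x y, congruent N x y -> f x = f y.
Proof.
move=> floc; apply: contrapT => /forallNP nunif.
have /choice[b bP] : forall N, exists xy : V * V, congruent N xy.1 xy.2 /\ f xy.1 <> f xy.2.
  move=> N; have /existsNP[x /existsNP[y /not_implyP[xy fxy]]] := nunif N.
  by exists (x, y).
pose tails : set_system (fin_normal G) :=
  fun A => exists N : fin_normal G, forall M : fin_normal G, sval M `<=` sval N -> A M.
have tailsF : ProperFilter tails.
  split; first by move=> [N /(_ N)]; apply.
  split=> [|A B [N NA] [M MB]|A B AB [N NA]].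
  - by have [N finN] := normal_setT_finite G; exists (exist _ N finN).
  - have [K [KN KM]] := fin_normal_meet N M; exists K => L LK.
    by split; [apply: NA => x /LK/KN|apply: MB => x /LK/KM].
  - by exists N => M /NA; apply: AB.
have [U [UU tailsU]] := ultraFilterLemma tailsF.
(* An ultrafilter selects one value of any function to a finite set; this yields the coordinates of
   the limit. *)
have finite_choice (Q : eqType) (q : fin_normal G -> Q) : finite_set [set: Q] ->
    exists a, U [set M | q M = a].
  move=> /finite_seqP[s sP].
  have : U [set M | q M \in s].
    by apply: filterS filterT => M _; have : [set: Q] (q M) by []; rewrite sP.
  elim: s {sP} => [|a s IHs] Us.
    by case: (filter_ex Us).
  have [Ua|nUa] := in_ultra_setVsetC [set M | q M = a] UU; first by exists a.
  apply: IHs; apply: filterS (filterI Us nUa) => M /= []; rewrite inE => /orP[/eqP|//].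
  by move=> qa nqa; case: nqa.
have ex_limit j N : exists a, U [set M | profinite_proj ((b M).1 j) N = a].
  by apply: finite_choice; exact: (svalP N).
pose z j N := projT1 (cid (ex_limit j N)).
have zP j N : U [set M | profinite_proj ((b M).1 j) N = z j N] := projT2 (cid (ex_limit j N)).
(* Two coordinates of the limit are attained together at some index, where they are compatible. *)
have zc j : compatible (z j).
  move=> N M NM; have [K [KN KM]] := filter_ex (filterI (zP j N) (zP j M)).
  by rewrite -[z j N]KN -[z j M]KM /= profinite_projP.
pose x : V := fun j => mk_profinite (zc j).
have [N Nx] := floc x.
have Ux : U [set M | forall j, profinite_proj ((b M).1 j) N = profinite_proj (x j) N].
  apply: (@filter_forall _ 'I_n
    (fun j => [set M | profinite_proj ((b M).1 j) N = profinite_proj (x j) N])).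
  by move=> j; exact: (zP j N).
have UN : U [set M : fin_normal G | sval M `<=` sval N] by apply: tailsU; exists N.
have [M [Mx MN]] := filter_ex (filterI Ux UN).
have [bM] := bP M; apply; rewrite (Nx _ Mx); apply/esym/Nx => j.
by rewrite -(Mx j); apply/esym/(profinite_proj_sub MN (bM j)).
Qed.

End Power.
End ProfiniteTopology.

(** * The comparison map *)

Section LowDegreeCochains.
Import GRing.Theory.
Local Open Scope ring_scope.
Local Open Scope group_scope.
Local Open Scope classical_set_scope.
Variables (G : groupType) (A : gmodule G).

Definition tup1 (a : G) : 'I_1 -> G := fun=> a.
Definition tup2 (a b : G) : 'I_2 -> G := fun j => if j == ord0 then a else b.
Definition tup3 (a b c : G) : 'I_3 -> G :=
  fun j => if j == ord0 then a else tup2 b c (inord j.-1).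

Lemma tup1E (u : 'I_1 -> G) : u = tup1 (u ord0).
Proof. by apply/funext => j; rewrite (ord1 j). Qed.

Lemma tup2E (u : 'I_2 -> G) : u = tup2 (u ord0) (u ord_max).
Proof.
by apply/funext => -[[|[|//]] lt]; rewrite /tup2 -val_eqE /=; congr u; apply/val_inj.
Qed.

Lemma tup3E (u : 'I_3 -> G) : u = tup3 (u ord0) (u (inord 1)) (u ord_max).
Proof.
apply/funext => -[[|[|[|//]]] lt]; rewrite /tup3 /tup2 -!val_eqE /= ?inordK //=;
by congr u; apply/val_inj; rewrite /= ?inordK.
Qed.

Lemma differential1 (f : cochain A 1) (g : 'I_2 -> G) :
  differential f g = bar1 (fun a => f (tup1 a)) (g ord0) (g ord_max).
Proof.
rewrite /differential big_ord_recl big_ord0 /= addr0 /bar1.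
rewrite [fun j => g (lift ord0 j)]tup1E [fun j => g (widen_ord _ j)]tup1E.
rewrite [merge_at _ _]tup1E /merge_at /= expr1 sqrrN expr1n mulrNz !mulr1z.
by congr (gact _ (f (tup1 (g _))) - f (tup1 (g _ * g _)%g) + f (tup1 (g _)))%R;
  apply/val_inj.
Qed.

Lemma differential2 (f : cochain A 2) (g : 'I_3 -> G) :
  differential f g = bar2 (fun a b => f (tup2 a b)) (g ord0) (g (inord 1)) (g ord_max).
Proof.
rewrite /differential !big_ord_recl big_ord0 /= addr0 /bar2.
rewrite [fun j => g (lift ord0 j)]tup2E [fun j => g (widen_ord _ j)]tup2E.
rewrite [merge_at ord0 _]tup2E [merge_at (lift _ _) _]tup2E /merge_at /=.
rewrite expr1 sqrrN expr1n exprS sqrrN expr1n mulr1 !mulrNz !mulr1z.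
rewrite addrA.
by congr (gact _ (f (tup2 (g _) (g _))) - f (tup2 (g _ * g _)%g (g _))
   + f (tup2 (g _) (g _ * g _)%g) - f (tup2 (g _) (g _)))%R;
  apply/val_inj; rewrite /= ?inordK.
Qed.

Lemma differential_differential1 (f : cochain A 1) : differential (differential f) = 0%R.
Proof.
apply/funext => g; rewrite differential2.
have -> : (fun a b => differential f (tup2 a b)) = bar1 (fun a => f (tup1 a)).
  by apply/funext => a; apply/funext => b; rewrite differential1.
exact: bar2_bar1.
Qed.

Definition locally_constant n (f : cochain A n) := exists N : normal_subgroup G,
  finite_index N /\ forall x y, (forall j, normal_set N ((x j)^-1 * y j)) -> f x = f y.

Lemma locally_constant0 (f : cochain A 0) : locally_constant f.
Proof.
have [N finN] := normal_setT_finite G; exists N; split=> // x y _.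
by congr f; apply/funext => -[].
Qed.

(** This is [coboundary_invariant] with [C] reduced to zero. *)
Lemma locally_constant_bar1 (f : cochain A 1) : finite_set [set: A] ->
  locally_constant (differential f) -> locally_constant f.
Proof.
move=> finA [N0 [finN0 fN0]].
pose N := normal_meet N0 (action_kernel A).
have finN : finite_index N := finite_index_meet finN0 (finite_index_action_kernel finA).
pose k a := f (tup1 a); pose F a b := differential f (tup2 a b).
have FN : invariant2 N F.
  by move=> x x' y y' [Nx _] [Ny _]; apply: fN0 => j; rewrite /tup2; case: ifP.
have kF a b : [set 0%R] (bar1 k a b - F a b)%R.
  by rewrite /F differential1 /= subrr.
have C1 (u v : A) : [set 0%R] u -> [set 0%R] v -> [set 0%R] (u - v)%R.
  by move=> /= -> ->; rewrite subrr.
have C2 g (u : A) : [set 0%R] u -> [set 0%R] (gact g u) by move=> /= ->; exact: gact0.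
have [M [finM _ Mk]] := coboundary_invariant finA (erefl : [set 0%R] 0%R) C1 C2 finN
  (fun n nN => proj2 nN) FN kF.
exists M; split=> // x y xy; rewrite [x]tup1E [y]tup1E.
by apply/eqP; rewrite eq_sym -subr_eq0; apply/eqP/Mk.
Qed.

Lemma locally_constant_one_cocycle (f : cochain A 1) : finite_set [set: A] ->
  differential f = 0%R -> locally_constant f.
Proof.
move=> finA f0; apply: locally_constant_bar1 => //; rewrite f0.
by have [N finN] := normal_setT_finite G; exists N.
Qed.

Lemma locally_constant_two_cocycle (f : cochain A 2) : two_cocycles_invariant G ->
  finite_set [set: A] -> differential f = 0%R ->
  exists h : cochain A 1, locally_constant (f - differential h)%R.
Proof.
move=> H2 finA f0.
have [a b c|k [M [finM kM]]] := H2 A (fun a b => f (tup2 a b)) finA.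
  have := differential2 f (tup3 a b c); rewrite f0 => E; apply/esym.
  by move: E; rewrite {1}/tup3 /tup3 /tup2 -!val_eqE /= !inordK.
exists (fun x => - k (x ord0))%R, M; split=> // x y xy.
have E z : (f - differential (fun x => - k (x ord0)))%R z =
    (f (tup2 (z ord0) (z ord_max)) + bar1 k (z ord0) (z ord_max))%R.
  have -> : (f - differential (fun x => - k (x ord0)))%R z =
    (f z - differential (fun x : 'I_1 -> G => - k (x ord0)) z)%R by [].
  rewrite differential1 {1}[z]tup2E /bar1 !gactN; zmod.
by rewrite !E; apply: kM; apply: xy.
Qed.

Lemma locally_constant_bar2 (f : cochain A 2) : two_cocycles_invariant G ->
  finite_set [set: A] -> locally_constant (differential f) ->
  exists h : cochain A 2, locally_constant h /\ differential h = differential f.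
Proof.
move=> H2 finA [N [finN fN]].
have tupN a a' b b' c c' : normal_set N (a^-1 * a') -> normal_set N (b^-1 * b') ->
    normal_set N (c^-1 * c') -> forall j, normal_set N ((tup3 a b c j)^-1 * tup3 a' b' c' j).
  by move=> Na Nb Nc j; rewrite /tup3 /tup2; case: ifP => // _; case: ifP.
have [|a b c|h [M [finM hM hE]]] := @invariant_three_coboundary G A
  (fun a b c => differential f (tup3 a b c)) (fun a b => f (tup2 a b)) N H2 finA finN.
- by move=> a a' b b' c c' Na Nb Nc; apply: fN; apply: tupN.
- rewrite differential2 {1}/tup3 /tup3 /tup2 -!val_eqE /= !inordK //.
exists (fun x => h (x ord0) (x ord_max)); split.
  by exists M; split=> // x y xy; apply: hM.
apply/funext => g; rewrite [g in RHS]tup3E -hE differential2.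
by rewrite /bar2 /tup2.
Qed.

End LowDegreeCochains.

Section Comparison.
Import GRing.Theory.
Local Open Scope ring_scope.
Local Open Scope group_scope.
Local Open Scope classical_set_scope.
Local Open Scope quotient_scope.
Variables (G : groupType) (A : gmodule (profinite_completion G)).
Local Notation P := (profinite_completion G).
Local Notation A' := (restrict_module (@completion_map G) A).
Hypothesis finA : finite_set [set: A].
Hypothesis act_cont : continuous (fun p : P * discrete_topology A =>
  gact p.1 (p.2 : A) : discrete_topology A).

Lemma continuous_uniform n (f : cochain A n) : continuous_cochain f ->
  exists N, forall x y, congruent N x y -> f x = f y.
Proof.
move=> cf; apply: uniformly_congruent => x; apply: congruent_nbhs.
apply: (cf x [set f x]); exact: (@discrete_set1 (discrete_topology A)).
Qed.

Lemma uniform_continuous n (f : cochain A n) N :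
  (forall x y, congruent N x y -> f x = f y) -> continuous_cochain f.
Proof.
move=> fN x U /nbhs_singleton Ux.
have FF : Filter (nbhs (x : {ptws 'I_n -> P})) by exact: nbhs_filter.
apply: (filterS (F := nbhs (x : {ptws 'I_n -> P})) _ (nbhs_congruent x N)) => y /fN E.
by rewrite /= E.
Qed.

(** Continuity fixes the action on one element of [A] near a given [g]; finiteness of [A] makes this
    simultaneous for all elements, and compactness makes it uniform in [g]. *)
Lemma action_uniform : exists N : fin_normal G, forall (g h : P),
  profinite_proj g N = profinite_proj h N -> forall a : A, gact g a = gact h a.
Proof.
have [g|N NP] := @uniformly_congruent G 1 (A -> A) (fun g => gact (g ord0)).
  have /finite_seqP[s sP] := finA.
  have [N NP] : exists N, forall h : 'I_1 -> P, congruent N h g ->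
      forall a, a \in s -> gact (h ord0) a = gact (g ord0) a.
    elim: s {sP} => [|a s [N IHN]].
      by have [N finN] := normal_setT_finite G; exists (exist _ N finN).
    have [M MP] : exists M, forall h : 'I_1 -> P, congruent M h g ->
        gact (h ord0) a = gact (g ord0) a.
      have : nbhs ((g ord0, a) : P * discrete_topology A)
          [set p | gact p.1 (p.2 : A) = gact (g ord0) a].
        apply: (@act_cont (g ord0, a) [set gact (g ord0) a]).
        exact: (@discrete_set1 (discrete_topology A)).
      case=> -[U U'] /= [/profinite_nbhs[M MU] U'a] UU'; exists M => h hg.
      by apply: (UU' (h ord0, a)); split; [exact/MU/hg|exact: nbhs_singleton U'a].
    have [K [KN KM]] := fin_normal_meet N M; exists K => h hg b; rewrite inE.
    case/orP => [/eqP ->|]; first exact/MP/(congruent_sub KM).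
    exact/IHN/(congruent_sub KN).
  exists N => h /NP hg; apply/funext => a; apply: hg.
  by have : [set: A] a by []; rewrite sP.
exists N => g h gh; have := NP (fun=> g) (fun=> h) (fun=> gh).
by move=> E a; rewrite E.
Qed.

Lemma differential_uniform n (f : cochain A n) N :
  (forall x y, congruent N x y -> f x = f y) ->
  exists M, forall x y, congruent M x y -> differential f x = differential f y.
Proof.
move=> fN; have [N' N'P] := action_uniform; have [M [MN MN']] := fin_normal_meet N N'.
exists M => x y xy; rewrite /differential (N'P (x ord0) (y ord0)); last first.
  exact: profinite_proj_sub MN' (xy ord0).
have {}xy := congruent_sub MN xy.
congr (gact _ _ + _ + _ *~ _)%R; [|apply: eq_bigr => i _; congr (_ *~ _)%R|]; apply: fN => j.
- exact: xy.
- rewrite /merge_at; case: ifP => _; first exact: xy.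
  case: ifP => _; last exact: xy.
  by rewrite -[LHS]/(profinite_proj _ N * profinite_proj _ N) !xy.
- exact: xy.
Qed.

(** The image of [G] is dense: every tuple is congruent modulo [M] to a tuple from [G]. *)
Lemma continuous_eq n (f f' : cochain A n) : continuous_cochain f -> continuous_cochain f' ->
  restrict_cochain f = restrict_cochain f' -> f = f'.
Proof.
move=> /continuous_uniform[N fN] /continuous_uniform[N' f'N'] E; apply/funext => x.
have [M [MN MN']] := fin_normal_meet N N'.
pose g j := repr (profinite_proj (x j) M).
have xg : congruent M x (fun j => completion_map (g j)).
  by move=> j; rewrite -[RHS]/(coset_map (sval M) (g j)) /coset_map reprK.
rewrite (fN _ _ (congruent_sub MN xg)) (f'N' _ _ (congruent_sub MN' xg)).
exact: (congr1 (fun h : cochain A' n => h g) E).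
Qed.

Lemma restrict_continuous n (f : cochain A n) : continuous_cochain f ->
  locally_constant (restrict_cochain f).
Proof.
move=> /continuous_uniform[N fN]; exists (sval N); split; first exact: svalP.
by move=> x y xy; apply: fN => j; apply/cosetE/xy.
Qed.

Lemma locally_constant_restrict n (f : cochain A' n) : locally_constant f ->
  exists F : cochain A n, continuous_cochain F /\ restrict_cochain F = f.
Proof.
move=> [N0 [finN fN]]; pose N : fin_normal G := exist _ N0 finN.
exists (fun x => f (fun j => repr (profinite_proj (x j) N))); split.
  by apply: (@uniform_continuous _ _ N) => x y xy; congr f; apply/funext => j; rewrite xy.
apply/funext => x; apply: fN => j; apply/cosetE.
by rewrite -[profinite_proj _ N]/(coset_map N0 (x j)) /coset_map reprK.
Qed.

Lemma differential_continuous n (f : cochain A n) : continuous_cochain f ->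
  continuous_cochain (differential f).
Proof.
by move=> /continuous_uniform[N /differential_uniform[M dfM]]; apply: uniform_continuous dfM.
Qed.

Lemma comparison_injective n :
  (forall f : cochain A n, continuous_cochain f ->
     is_coboundary (all_cochains A') (restrict_cochain f) ->
     is_coboundary (continuous_cochains A) f) ->
  injective (@comparison_map G A n).
Proof.
move=> H x y; rewrite -[x]reprK -[y]reprK.
move: (repr x) (repr y) => f f'; rewrite !comparison_mapE => /eqmodP/asboolP E.
apply/eqmodP/asboolP/H; last exact: E.
have /asboolP[cf _] := svalP f; have /asboolP[cf' _] := svalP f'.
exact: continuous_cochainB.
Qed.

Lemma comparison_injective0 : injective (@comparison_map G A 0).
Proof.
apply: comparison_injective => f cf /= f0; apply: continuous_eq => //.
exact: continuous_cochain0.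
Qed.

(** If a continuous [f] restricts to [differential h], the latter is locally constant. A locally
    constant [h'] with the same differential extends continuously, and by density [f] is the
    differential of the extension. *)
Lemma comparison_injectiveS n :
  (forall h : cochain A' n, locally_constant (differential h) ->
     exists h' : cochain A' n, locally_constant h' /\ differential h' = differential h) ->
  injective (@comparison_map G A n.+1).
Proof.
move=> H; apply: comparison_injective => f cf /= [h _ fh].
have [|h' [h'c h'h]] := H h; first by rewrite -fh; apply: restrict_continuous.
have [F [cF FE]] := locally_constant_restrict h'c.
exists F => //; apply: continuous_eq => //; first exact: differential_continuous.
by rewrite -differential_restrict FE h'h.
Qed.

Lemma comparison_surjective n :
  (forall f : cochain A' n, differential f = 0%R -> exists f' : cochain A' n,
     [/\ locally_constant f', differential f' = 0%R &
         is_coboundary (all_cochains A') (f - f')%R]) ->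
  forall z, exists x, z = @comparison_map G A n x.
Proof.
move=> H z; rewrite -[z]reprK; move: (repr z) => f.
have /asboolP[_ df] := svalP f; have [f' [f'c df' ff']] := H _ df.
have [F [cF FE]] := locally_constant_restrict f'c.
have cocF : `[< is_cocycle (continuous_cochains A) F >].
  apply/asboolP; split=> //; apply: continuous_eq.
  - exact: differential_continuous.
  - exact: continuous_cochain0.
  - by rewrite -differential_restrict FE df'.
pose Fc : cocycle (continuous_cochains A) n := exist _ F cocF.
exists (\pi_(cohomology _ n) Fc); rewrite comparison_mapE; apply/eqmodP/asboolP.
by rewrite /= FE.
Qed.

Lemma bijective_of_surjective (T U : Type) (f : T -> U) :
  injective f -> (forall z, exists x, z = f x) -> bijective f.
Proof.
move=> fI fS; have [g gP] := choice fS; exists g => [x|z]; last by rewrite -gP.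
by apply: fI; rewrite -gP.
Qed.

End Comparison.

(** Cocycles of degree 0 and 1 are already locally constant; the hypothesis enters in surjectivity
    in degree 2 and injectivity in degree 3. *)
Lemma class_A_2 (G : groupType) : two_cocycles_invariant G -> class_A 2 G.
Proof.
move=> H2 A finA Acont.
have finA' : finite_set [set: restrict_module (@completion_map G) A]%classic by [].
have inj1 : injective (@comparison_map G A 1).
  by apply: comparison_injectiveS => // h _; exists h; split=> //; apply: locally_constant0.
have inj2 : injective (@comparison_map G A 2).
  apply: comparison_injectiveS => // h hc; exists h; split=> //.
  exact: locally_constant_bar1.
split; last by apply: comparison_injectiveS => // h; apply: locally_constant_bar2.
have self n (f : cochain (restrict_module (@completion_map G) A) n) :
    is_coboundary (all_cochains _) (f - f)%R.
  by rewrite GRing.subrr; apply: is_coboundary0.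
move=> [|[|[|//]]] _; apply: bijective_of_surjective => //.
- exact: comparison_injective0.
- apply: comparison_surjective => // f df; exists f; split=> //; exact: locally_constant0.
- apply: comparison_surjective => // f df; exists f; split=> //.
  exact: locally_constant_one_cocycle.
- apply: comparison_surjective => // f df.
  have [h hc] := locally_constant_two_cocycle H2 finA' df.
  exists (f - differential h)%R; split=> //.
    by rewrite differentialB df differential_differential1 GRing.subrr.
  by exists h => //; rewrite GRing.subKr.
Qed.

Theorem theorem4p8 (G : groupType) (phi : {multiplicative G -> G})
  (G_free : free_of_finite_rank G) (phi_inj : injective phi) :
  highly_residually_finite (ascending_hnn phi).
Proof.
split; first exact: ascending_hnn_residually_finite.
apply: class_A_2 => A f finA fc; have [n [iso iso_bij]] := G_free.
exact: (hnn_two_cocycle_invariant iso_bij finA fc).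
Qed.
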